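(* Let $K$ be a compact Hausdorff space such that the C*-algebra $C(K)$ of complex-valued continuous functions on $K$ is $*$-isomorphic to a masa of the Calkin algebra $\mathcal Q(\ell_2)$. Then $K$ has no point of character less than the pseudointersection number $\mathfrak p$; that is, $\chi(x)\geq\mathfrak p$ for every $x\in K$.
   Context: $\mathcal B(\ell_2)$ is the C*-algebra of bounded linear operators on the (complex, separable, infinite-dimensional) Hilbert space $\ell_2$, $\mathcal K(\ell_2)$ is its ideal of compact operators, and $\mathcal Q(\ell_2)=\mathcal B(\ell_2)/\mathcal K(\ell_2)$ is the Calkin algebra. A masa of a C*-algebra is a C*-subalgebra which is commutative and maximal with respect to inclusion among commutative C*-subalgebras. The character $\chi(x)$ of a point $x$ of a topological space is the minimal cardinality of a basis of neighbourhoods at $x$. The pseudointersection number $\mathfrak p$ is the least cardinality of a family $\mathcal F$ of infinite subsets of $\mathbb N$ such that every intersection of nonempty finitely many members of $\mathcal F$ is infinite and there is no infinite $X\subseteq\mathbb N$ such that $X\setminus F$ is finite for every $F\in\mathcal F$. *)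

(* Defs.v *)
From HB Require Import structures.
From mathcomp Require Import all_boot all_order all_algebra.
From mathcomp Require Import finmap complex ring lra.
From mathcomp Require Import all_classical all_reals all_analysis.

Set Implicit Arguments.
Unset Strict Implicit.
Unset Printing Implicit Defensive.

Import Order.TTheory GRing.Theory Num.Theory.
Import numFieldNormedType.Exports.

Local Open Scope classical_set_scope.
Local Open Scope ring_scope.
Local Open Scope complex_scope.
Local Open Scope card_scope.

(* The topology and norm of numFieldType are only canonical on variables and
   on R^o; this makes the usual topology of the complex numbers canonical on
   R[i] itself. *)
HB.instance Definition _ (R : realType) := NormedModule.copy R[i] R[i]^o.

Section RealSeries.
Context {R : realType}.
Implicit Types (u v : R^nat) (M : R).

Lemma bounded_series_cvg u M : (forall n, 0 <= u n) ->
  (forall n, series u n <= M) -> cvgn (series u) /\ limn (series u) <= M.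
Proof.
move=> u0 uM; have cu : cvgn (series u).
  apply: nondecreasing_is_cvgn; first by apply: nondecreasing_series.
  by exists M => _ [n _ <-].
by split=> //; apply: limr_le => //; apply: nearW.
Qed.

Lemma series_le_limn u n : (forall n, 0 <= u n) -> cvgn (series u) ->
  series u n <= limn (series u).
Proof.
move=> u0 cu; apply: nondecreasing_cvgn_le => //.
by apply: nondecreasing_series.
Qed.

End RealSeries.

Section SquareSummable.
Context {R : realType}.
Local Notation C := (R[i]).
Local Notation normc := (@ComplexField.Normc.normc R).
Implicit Types (x y : nat -> C).

Definition sqabs (x : nat -> C) : R^nat := fun n => normc (x n) ^+ 2.

Definition square_summable : {pred (nat -> C)} :=
  [pred x | `[< cvgn (series (sqabs x)) >]].

Definition sqnorm x : R := limn (series (sqabs x)).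

Lemma normc_ge0 (z : C) : 0 <= normc z.
Proof. by case: z => a b; exact: sqrtr_ge0. Qed.

Lemma normCE (z : C) : `|z| = (normc z)%:C.
Proof. by []. Qed.

Lemma sqabs_ge0 x n : 0 <= sqabs x n.
Proof. by rewrite sqr_ge0. Qed.

Lemma sqnorm_ge0 x : x \in square_summable -> 0 <= sqnorm x.
Proof.
move=> /asboolP cx; rewrite (le_trans _ (series_le_limn 0 (sqabs_ge0 x) cx))//.
by rewrite /series/= big_geq.
Qed.

Lemma sqnorm_eq0 x : x \in square_summable -> sqnorm x = 0 -> x = 0.
Proof.
move=> /asboolP cx x0; apply/funext => n /=.
have /= := series_le_limn n.+1 (sqabs_ge0 x) cx.
rewrite -[limn _]/(sqnorm x) x0 /series/= big_nat_recr//= => le0.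
have s0 : 0 <= \sum_(0 <= k < n) sqabs x k.
  by apply: sumr_ge0 => k _; exact: sqabs_ge0.
have : sqabs x n <= 0 by apply: le_trans le0; rewrite lerDr.
rewrite /sqabs => {}le0; apply: ComplexField.Normc.eq0_normc.
by apply/eqP; rewrite -sqrf_eq0 eq_le le0 sqr_ge0.
Qed.

Lemma sqabsZ (a : C) x : sqabs (a *: x) = normc a ^+ 2 *: sqabs x.
Proof.
by apply/funext => n; rewrite /sqabs/= ComplexField.Normc.normcM exprMn.
Qed.

Lemma square_summableZ (a : C) x : x \in square_summable ->
  a *: x \in square_summable /\ sqnorm (a *: x) = normc a ^+ 2 * sqnorm x.
Proof.
move=> /asboolP cx; have := is_cvg_seriesZ (k := normc a ^+ 2) cx.
rewrite -sqabsZ => cax; split; first exact/asboolP.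
by rewrite /sqnorm sqabsZ lim_seriesZ.
Qed.

Lemma sqabsD_le (t : R) x y n : 0 < t ->
  sqabs (x + y) n <= (1 + t) * sqabs x n + (1 + t^-1) * sqabs y n.
Proof.
move=> t0; rewrite /sqabs/=.
have : normc (x n + y n) <= normc (x n) + normc (y n).
  exact: le_normcD.
move: (normc_ge0 (x n + y n)) (normc_ge0 (x n)) (normc_ge0 (y n)).
move: (normc (x n + y n)) (normc (x n)) (normc (y n)) => c a b c0 a0 b0 cab.
apply: (@le_trans _ _ ((a + b) ^+ 2)); first by rewrite ler_sqr ?nnegrE//; lra.
rewrite -subr_ge0.
have -> : (1 + t) * a ^+ 2 + (1 + t^-1) * b ^+ 2 - (a + b) ^+ 2 =
          t * (a - t^-1 * b) ^+ 2 by field; rewrite gt_eqF.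
by rewrite mulr_ge0 ?sqr_ge0// ltW.
Qed.

Lemma square_summableD_le (t : R) x y : 0 < t ->
  x \in square_summable -> y \in square_summable ->
  x + y \in square_summable /\
  sqnorm (x + y) <= (1 + t) * sqnorm x + (1 + t^-1) * sqnorm y.
Proof.
move=> t0 /asboolP cx /asboolP cy.
have [|c le] := @bounded_series_cvg _ (sqabs (x + y))
    ((1 + t) * sqnorm x + (1 + t^-1) * sqnorm y) (sqabs_ge0 _).
  move=> n; apply: (@le_trans _ _
    (series ((1 + t) *: sqabs x + (1 + t^-1) *: sqabs y) n)).
    by apply: ler_sum => k _; exact: sqabsD_le.
  rewrite seriesD !seriesZ /=; apply: lerD.
  - rewrite ler_wpM2l ?addr_ge0 ?(ltW t0)//.
    exact: (series_le_limn n (sqabs_ge0 x) cx).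
  - rewrite ler_wpM2l ?addr_ge0 ?invr_ge0 ?(ltW t0)//.
    exact: (series_le_limn n (sqabs_ge0 y) cy).
by split => //; apply/asboolP.
Qed.

Lemma square_summable0 : (0 : nat -> C) \in square_summable.
Proof.
apply/asboolP; have [] // := @bounded_series_cvg _ (sqabs 0) 0 (sqabs_ge0 0).
move=> n; rewrite /series/= big1// => k _.
by rewrite /sqabs ComplexField.Normc.normc0 expr0n.
Qed.

Lemma square_summable_submod : submod_closed square_summable.
Proof.
split; first exact: square_summable0.
move=> a x y sx sy.
exact: (square_summableD_le ltr01 (square_summableZ a sx).1 sy).1.
Qed.

End SquareSummable.

HB.instance Definition _ (R : realType) :=
  GRing.isSubmodClosed.Build _ _ (@square_summable R) (@square_summable_submod R).

(* Sequences with summable squared moduli, with norm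
   l2norm x = (\sum_n |x_n|^2)^(1/2) and inner product dotl2, linear in its
   first argument. *)
Definition ell2 (R : realType) := {x : nat -> R[i] | x \in square_summable}.

Section Ell2.
Context {R : realType}.
Local Notation normc := (@ComplexField.Normc.normc R).

HB.instance Definition _ := SubChoice.on (ell2 R).
HB.instance Definition _ := [SubChoice_isSubLmodule of ell2 R by <:].

Definition l2norm (x : ell2 R) : R := Num.sqrt (sqnorm (val x)).

Lemma l2norm_ge0 (x : ell2 R) : 0 <= l2norm x.
Proof. exact: sqrtr_ge0. Qed.

Lemma l2norm_sqr (x : ell2 R) : l2norm x ^+ 2 = sqnorm (val x).
Proof. by rewrite sqr_sqrtr// sqnorm_ge0//; exact: valP. Qed.

Lemma l2norm_eq0 (x : ell2 R) : l2norm x = 0 -> x = 0.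
Proof.
move=> x0; apply: val_inj; apply: sqnorm_eq0; first exact: valP.
by rewrite -l2norm_sqr x0 expr0n.
Qed.

Lemma l2normZ (a : R[i]) (x : ell2 R) : l2norm (a *: x) = normc a * l2norm x.
Proof.
rewrite /l2norm GRing.valZ (square_summableZ a (valP x)).2.
by rewrite sqrtrM ?sqr_ge0// sqrtr_sqr ger0_norm// normc_ge0.
Qed.

Lemma l2normD (x y : ell2 R) : l2norm (x + y) <= l2norm x + l2norm y.
Proof.
have [/l2norm_eq0->|x0] := eqVneq (l2norm x) 0.
  by rewrite add0r lerDr l2norm_ge0.
have [/l2norm_eq0->|y0] := eqVneq (l2norm y) 0.
  by rewrite addr0 lerDl l2norm_ge0.
have {}x0 : 0 < l2norm x by rewrite lt_neqAle eq_sym x0 l2norm_ge0.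
have {}y0 : 0 < l2norm y by rewrite lt_neqAle eq_sym y0 l2norm_ge0.
rewrite -ler_sqr ?nnegrE ?addr_ge0 ?l2norm_ge0// l2norm_sqr GRing.valD.
have t0 : 0 < l2norm y / l2norm x by rewrite divr_gt0.
apply: (le_trans (square_summableD_le t0 (valP x) (valP y)).2).
rewrite -!l2norm_sqr le_eqVlt; apply/orP; left; apply/eqP.
by field; rewrite !gt_eqF.
Qed.

Let l2normC (x : ell2 R) : R[i] := (l2norm x)%:C.

Let l2normCD x y : l2normC (x + y) <= l2normC x + l2normC y.
Proof. by rewrite /l2normC -rmorphD lecR l2normD. Qed.

Let l2normCZ (a : R[i]) x : l2normC (a *: x) = `|a| * l2normC x.
Proof. by rewrite /l2normC l2normZ rmorphM normCE. Qed.

Let l2normC_eq0 x : l2normC x = 0 -> x = 0.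
Proof. by move=> /complexI/l2norm_eq0. Qed.

HB.instance Definition _ :=
  Lmodule_isNormed.Build R[i] (ell2 R) l2normCD l2normCZ l2normC_eq0.

Lemma normr_ell2E (x : ell2 R) : `|x| = (l2norm x)%:C.
Proof. by []. Qed.

End Ell2.

Section Inner.
Context {R : realType}.
Local Notation normc := (@ComplexField.Normc.normc R).
Implicit Types x y z : ell2 R.

Lemma cvg_real_complex (u : R^nat) (l : R) : u @ \oo --> l ->
  (fun n => (u n)%:C : R[i]) @ \oo --> (l%:C : R[i]).
Proof.
move=> /cvgrPdist_lt ul; apply/cvgrPdist_lt => e; rewrite ltcE/=.
move=> /andP[/eqP e0 epos]; apply: filterS (ul _ epos) => n.
by rewrite -rmorphB normCE/= ltcE/= e0 eqxx/= expr0n addr0 sqrtr_sqr.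
Qed.

Lemma cvg_conjc (u : nat -> R[i]) (l : R[i]) : u @ \oo --> l ->
  (fun n => (u n)^*) @ \oo --> l^*.
Proof.
move=> /cvgrPdist_lt ul; apply/cvgrPdist_lt => e e0.
by apply: filterS (ul _ e0) => n; rewrite -rmorphB normcJ.
Qed.

Lemma abs_series_cvg (u : nat -> R[i]) : cvgn (series (normc \o u)) ->
  cvgn (series u).
Proof.
move=> cu.
have cRe : cvgn (series (fun n => complex.Re (u n))).
  apply: normed_cvg; apply: series_le_cvg cu => [n|n|n] /=.
  - exact: normr_ge0.
  - exact: normc_ge0.
  - by rewrite -lecR -normCE normc_ge_Re.
have cIm : cvgn (series (fun n => complex.Im (u n))).
  apply: normed_cvg; apply: series_le_cvg cu => [n|n|n] /=.
  - exact: normr_ge0.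
  - exact: normc_ge0.
  - case: (u n) => a b /=.
    by rewrite -[leLHS]sqrtr_sqr ler_wsqrtr// lerDr sqr_ge0.
pose v := (fun n => (series (fun n => complex.Re (u n)) n)%:C +
  'i%C * (series (fun n => complex.Im (u n)) n)%:C) : nat -> R[i].
have -> : series u = v.
  apply/funext => n; rewrite /series/= /v/= !rmorph_sum mulr_sumr -big_split.
  by apply: eq_bigr => k _; exact: complexE.
apply/cvg_ex; eexists; apply: cvgD; last apply: cvgMr.
- exact: (cvg_real_complex cRe).
- exact: (cvg_real_complex cIm).
Qed.

Definition dotseq x y : nat -> R[i] := fun n => val x n * (val y n)^*.

Definition dotl2 x y : R[i] := limn (series (dotseq x y)).

Lemma normc_dotseq_le (t : R) x y n : 0 < t ->
  normc (dotseq x y n) <=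
    (t / 2) * sqabs (val x) n + (t^-1 / 2) * sqabs (val y) n.
Proof.
move=> t0; rewrite /dotseq ComplexField.Normc.normcM /sqabs.
have -> : normc (val y n)^* = normc (val y n).
  by apply: complexI; rewrite -!normCE normcJ.
move: (normc (val x n)) (normc (val y n)) => a b; rewrite -subr_ge0.
have -> : t / 2 * a ^+ 2 + t^-1 / 2 * b ^+ 2 - a * b =
          t / 2 * (a - t^-1 * b) ^+ 2 by field; rewrite gt_eqF.
by rewrite mulr_ge0 ?sqr_ge0// divr_ge0// ltW.
Qed.

Lemma series_normc_dotseq_le (t : R) x y n : 0 < t ->
  series (normc \o dotseq x y) n <=
    (t / 2) * l2norm x ^+ 2 + (t^-1 / 2) * l2norm y ^+ 2.
Proof.
move=> t0; apply: (@le_trans _ _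
    (series ((t / 2) *: sqabs (val x) + (t^-1 / 2) *: sqabs (val y)) n)).
  by apply: ler_sum => k _; exact: normc_dotseq_le.
rewrite seriesD !seriesZ/= !l2norm_sqr; apply: lerD.
- rewrite ler_wpM2l ?divr_ge0 ?(ltW t0)//.
  exact: (series_le_limn n (sqabs_ge0 _) (asboolW (valP x))).
- rewrite ler_wpM2l ?divr_ge0 ?invr_ge0 ?(ltW t0)//.
  exact: (series_le_limn n (sqabs_ge0 _) (asboolW (valP y))).
Qed.

Lemma cvg_dotseq x y : cvgn (series (dotseq x y)).
Proof.
apply: abs_series_cvg.
exact: (bounded_series_cvg (fun n => normc_ge0 _)
  (fun n => series_normc_dotseq_le x y n ltr01)).1.
Qed.

Lemma normc_lim_le (u : nat -> R[i]) (M : R) : cvgn u ->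
  (forall n, normc (u n) <= M) -> normc (limn u) <= M.
Proof.
move=> cu uM; rewrite leNgt; apply/negP => lt.
have /cvgrPdist_lt := cu => /(_ (normc (limn u) - M)%:C).
rewrite ltcR subr_gt0 => /(_ lt) [N _ /(_ N (leqnn N))]/=.
rewrite normCE ltcR ltNge => /negP; apply.
rewrite lerBlDr (@le_trans _ _ (normc (limn u - u N) + normc (u N)))//.
  by have := le_normcD (limn u - u N) (u N); rewrite subrK.
by rewrite lerD2l.
Qed.

Lemma dotl2_le (t : R) x y : 0 < t -> normc (dotl2 x y) <=
    (t / 2) * l2norm x ^+ 2 + (t^-1 / 2) * l2norm y ^+ 2.
Proof.
move=> t0; apply: normc_lim_le; first exact: cvg_dotseq.
move=> n; apply: le_trans (series_normc_dotseq_le x y n t0).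
rewrite -lecR -normCE /series/= rmorph_sum.
by apply: le_trans (ler_norm_sum _ _ _) _; apply: ler_sum => k _.
Qed.

Lemma dotl2DZl (a : R[i]) x z y :
  dotl2 (a *: x + z) y = a * dotl2 x y + dotl2 z y.
Proof.
rewrite /dotl2; have -> : dotseq (a *: x + z) y = a *: dotseq x y + dotseq z y.
  apply/funext => n; rewrite /dotseq GRing.valD GRing.valZ.
  rewrite -[LHS]/((a * val x n + val z n) * (val y n)^*) mulrDl -mulrA.
  by [].
rewrite lim_seriesD; first by rewrite lim_seriesZ//; exact: cvg_dotseq.
- by apply: is_cvg_seriesZ; exact: cvg_dotseq.
- exact: cvg_dotseq.
Qed.

Lemma dotl2C x y : dotl2 y x = (dotl2 x y)^*.
Proof.
have /(cvg_lim (@norm_hausdorff _ _)) <- := cvg_conjc (@cvg_dotseq x y).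
congr (limn _); apply/funext => n.
rewrite /series/= rmorph_sum; apply: eq_bigr => k _.
by rewrite /dotseq rmorphM/= conjcK mulrC.
Qed.

Lemma dotl20l y : dotl2 0 y = 0.
Proof.
have := dotl2DZl 1 0 0 y; rewrite scaler0 add0r mul1r => /eqP.
by rewrite eq_sym -subr_eq0 addrK => /eqP.
Qed.

Lemma dotl20r x : dotl2 x 0 = 0.
Proof. by rewrite dotl2C dotl20l rmorph0. Qed.

Lemma dotl2_CS x y : normc (dotl2 x y) <= l2norm x * l2norm y.
Proof.
have [/l2norm_eq0->|x0] := eqVneq (l2norm x) 0.
  rewrite dotl20l ComplexField.Normc.normc0.
  by rewrite mulr_ge0 ?l2norm_ge0.
have [/l2norm_eq0->|y0] := eqVneq (l2norm y) 0.
  rewrite dotl20r ComplexField.Normc.normc0.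
  by rewrite mulr_ge0 ?l2norm_ge0.
have {}x0 : 0 < l2norm x by rewrite lt_neqAle eq_sym x0 l2norm_ge0.
have {}y0 : 0 < l2norm y by rewrite lt_neqAle eq_sym y0 l2norm_ge0.
have t0 : 0 < l2norm y / l2norm x by rewrite divr_gt0.
apply: (le_trans (dotl2_le x y t0)).
rewrite le_eqVlt; apply/orP; left; apply/eqP.
by field; rewrite !gt_eqF.
Qed.

Lemma dotl2xx x : dotl2 x x = (l2norm x ^+ 2)%:C.
Proof.
rewrite l2norm_sqr; have /(cvg_lim (@norm_hausdorff _ _)) <- :=
  cvg_real_complex (asboolW (valP x)).
congr (limn _); apply/funext => n; rewrite /series/= rmorph_sum.
by apply: eq_bigr => k _; rewrite /dotseq -sqr_normc normCE rmorphXn.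
Qed.

End Inner.

Section Riesz.
Context {R : realType}.
Local Notation normc := (@ComplexField.Normc.normc R).
Implicit Types x y z : ell2 R.

Definition trunc_fun (N : nat) (x : nat -> R[i]) : nat -> R[i] :=
  fun k => if (k < N)%N then x k else 0.

Lemma sqabs_trunc N (x : nat -> R[i]) k :
  sqabs (trunc_fun N x) k = if (k < N)%N then sqabs x k else 0.
Proof.
rewrite /sqabs /trunc_fun; case: ifP => // _.
by rewrite ComplexField.Normc.normc0 expr0n.
Qed.

Lemma series_trunc_le N (x : nat -> R[i]) n :
  series (sqabs (trunc_fun N x)) n <= series (sqabs x) N.
Proof.
rewrite /series/=; have [nN|/ltnW Nn] := leqP n N.
  rewrite [leRHS](big_cat_nat (leq0n n) nN)//= ler_wpDr//.
    by apply: sumr_ge0 => k _; exact: sqabs_ge0.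
  rewrite [leLHS]big_nat [leRHS]big_nat; apply: ler_sum => k /andP[_ kn].
  by rewrite sqabs_trunc (leq_trans kn nN).
rewrite [leLHS](big_cat_nat (leq0n N) Nn)//= [X in _ + X]big_nat [X in _ + X]big1 ?addr0.
  by rewrite [leLHS]big_nat [leRHS]big_nat; apply: ler_sum => k /andP[_ kn];
    rewrite sqabs_trunc kn.
by move=> k /andP[Nk _]; rewrite sqabs_trunc ltnNge Nk.
Qed.

Lemma trunc_summable N (x : nat -> R[i]) : trunc_fun N x \in square_summable.
Proof.
apply/asboolP.
exact: (bounded_series_cvg (sqabs_ge0 _) (series_trunc_le N x)).1.
Qed.

Definition trunc (N : nat) (x : nat -> R[i]) : ell2 R :=
  Sub (trunc_fun N x) (trunc_summable N x).

Definition delta (n : nat) : ell2 R := trunc n.+1 (fun k => (k == n)%:R).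

Lemma val_delta n k : val (delta n) k = (k == n)%:R.
Proof.
rewrite /= /trunc_fun; case: ifP => // /negbT; rewrite -leqNgt => nk.
by rewrite gtn_eqF.
Qed.

Lemma val_sum (I : Type) (r : seq I) (F : I -> ell2 R) k :
  val (\sum_(i <- r) F i) k = \sum_(i <- r) val (F i) k.
Proof.
by elim/big_rec2: _ => // i y1 y2 _ <-; rewrite GRing.valD.
Qed.

Lemma truncE N (x : nat -> R[i]) :
  trunc N x = \sum_(0 <= n < N) x n *: delta n.
Proof.
apply: val_inj; apply/funext => k; rewrite val_sum -[LHS]/(trunc_fun N x k).
transitivity (\sum_(0 <= n < N) x n * (k == n)%:R); last first.
  apply: eq_bigr => n _.
  by rewrite GRing.valZ -[RHS]/(x n * val (delta n) k) val_delta.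
rewrite /trunc_fun; case: ifPn => kN.
  rewrite (bigD1_seq k)/= ?mem_index_iota ?iota_uniq// eqxx mulr1.
  by rewrite big1 ?addr0// => n; rewrite eq_sym => /negPf->; rewrite mulr0.
rewrite big_nat big1// => n /andP[_ nN]; rewrite gtn_eqF ?mulr0//.
by rewrite (leq_trans nN)// leqNgt.
Qed.

Lemma l2norm_trunc_sqr N (x : nat -> R[i]) :
  l2norm (trunc N x) ^+ 2 = series (sqabs x) N.
Proof.
rewrite l2norm_sqr/=; apply/eqP; rewrite eq_le; apply/andP; split.
  exact: (bounded_series_cvg (sqabs_ge0 _) (series_trunc_le N x)).2.
apply: le_trans (series_le_limn N (sqabs_ge0 _) (asboolW (trunc_summable N x))).
rewrite /series/= big_nat [leRHS]big_nat; apply: ler_sum => k /andP[_ kn].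
by rewrite sqabs_trunc kn.
Qed.

Lemma ell2_cvg x : cvgn (series (sqabs (val x))).
Proof. exact: (asboolW (valP x)). Qed.

Lemma cvg_trunc x : (fun N => l2norm (x - trunc N (val x))) @ \oo --> (0 : R).
Proof.
have le N : l2norm (x - trunc N (val x)) ^+ 2 <=
    sqnorm (val x) - series (sqabs (val x)) N.
  rewrite -l2norm_trunc_sqr !l2norm_sqr lerBrDr.
  rewrite -lim_seriesD; [|exact: ell2_cvg..].
  rewrite le_eqVlt; apply/orP; left; apply/eqP; congr (limn (series _)).
  apply/funext => k; rewrite -[LHS]/(sqabs _ k + sqabs _ k) sqabs_trunc.
  rewrite GRing.valB /sqabs -[(val x - _) k]/(val x k - _) /= /trunc_fun.
  case: ifP => _; last by rewrite subr0 addr0.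
  by rewrite subrr ComplexField.Normc.normc0 expr0n add0r.
have c0 : (fun N => Num.sqrt (sqnorm (val x) - series (sqabs (val x)) N))
    @ \oo --> (0 : R).
  rewrite -sqrtr0; apply: continuous_cvg; first exact: sqrt_continuous.
  rewrite -(subrr (sqnorm (val x))); apply: cvgB; first exact: cvg_cst.
  exact: (asboolW (valP x)).
apply: (squeeze_cvgr _ (cvg_cst 0) c0); apply: nearW => N.
rewrite l2norm_ge0/= -[leLHS]ger0_norm ?l2norm_ge0// -sqrtr_sqr.
by rewrite ler_wsqrtr.
Qed.

Definition functional_bound (f : ell2 R -> R[i]) (M : R) :=
  [/\ 0 <= M, (forall a x y, f (a *: x + y) = a * f x + f y) &
    forall x, normc (f x) <= M * l2norm x].

Lemma riesz (f : ell2 R -> R[i]) M : functional_bound f M ->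
  exists y, forall x, f x = dotl2 x y.
Proof.
move=> [M0 flin fM].
have f0 : f 0 = 0.
  have := flin 1 0 0; rewrite scaler0 add0r mul1r => /eqP.
  by rewrite eq_sym -subr_eq0 addrK => /eqP.
have fsum N (u : nat -> R[i]) :
    f (trunc N u) = \sum_(0 <= n < N) u n * f (delta n).
  rewrite truncE; elim: N => [|N IH]; first by rewrite !big_geq.
  by rewrite !big_nat_recr//= addrC flin IH addrC.
pose y : nat -> R[i] := fun n => (f (delta n))^*.
have yM n : series (sqabs y) n <= M ^+ 2.
  have fy : f (trunc n y) = (series (sqabs y) n)%:C.
    rewrite fsum /series/= rmorph_sum; apply: eq_bigr => k _.
    by rewrite mulrC /sqabs/= rmorphXn/= -normCE normcJ sqr_normc.
  have := fM (trunc n y); rewrite fy.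
  rewrite /ComplexField.Normc.normc/= expr0n addr0 sqrtr_sqr ger0_norm; last first.
    by apply: sumr_ge0 => k _; exact: sqabs_ge0.
  rewrite -l2norm_trunc_sqr; have [->|y0] := eqVneq (l2norm (trunc n y)) 0.
    by rewrite expr0n sqr_ge0.
  rewrite expr2 ler_pM2r; last by rewrite lt_neqAle eq_sym y0 l2norm_ge0.
  by move=> le; rewrite expr2 ler_pM ?l2norm_ge0.
have ys : y \in square_summable.
  by apply/asboolP; exact: (bounded_series_cvg (sqabs_ge0 _) yM).1.
exists (Sub y ys) => x; apply/esym/(cvg_lim (@norm_hausdorff _ _)).
have -> : series (dotseq x (Sub y ys)) = (fun N => f (trunc N (val x))).
  apply/funext => N; rewrite fsum /series/=; apply: eq_bigr => k _.
  by congr (_ * _); exact: conjcK.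
have fB u v : f (u - v) = f u - f v.
  by rewrite addrC -scaleN1r flin mulN1r addrC.
have Mx : (fun N => M * l2norm (x - trunc N (val x))) @ \oo --> (0 : R).
  by rewrite -(mulr0 M); apply: cvgMr; exact: cvg_trunc.
apply/cvgrPdist_lt => e; rewrite ltcE/= => /andP[/eqP e0 epos].
move/cvgrPdist_lt : Mx => /(_ _ epos); apply: filterS => N.
rewrite sub0r normrN ger0_norm ?mulr_ge0 ?l2norm_ge0// => lt.
rewrite -fB normCE ltcE/= e0 eqxx/=; exact: le_lt_trans (fM _) lt.
Qed.

Lemma dotl2_inj y z : (forall x, dotl2 x y = dotl2 x z) -> y = z.
Proof.
move=> yz; apply/eqP; rewrite -subr_eq0; apply/eqP/l2norm_eq0/eqP.
rewrite -sqrf_eq0 -(inj_eq (@complexI R)) rmorph0 -dotl2xx; apply/eqP.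
set w := y - z; rewrite dotl2C {1}/w addrC -scaleN1r dotl2DZl.
by rewrite (dotl2C w z) (dotl2C w y) yz mulN1r addNr rmorph0.
Qed.

Lemma dotl2DZr (a : R[i]) x y z :
  dotl2 x (a *: y + z) = a^* * dotl2 x y + dotl2 x z.
Proof.
by rewrite dotl2C dotl2DZl rmorphD rmorphM/= -!dotl2C.
Qed.

End Riesz.

(* Bounded linear operators; the ring product of bop R is composition. *)
Definition bounded_op {R : realType} : {pred (ell2 R -> ell2 R)} :=
  [pred T | `[< linear T /\
    exists M : R, forall x, l2norm (T x) <= M * l2norm x >]].

Lemma bounded_op_submod (R : realType) : submod_closed (@bounded_op R).
Proof.
split.
  apply/asboolP; split=> [a x y|]; first by rewrite scaler0 add0r.
  exists 0 => x; rewrite mul0r -[leLHS]/(l2norm 0).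
  by rewrite -[0 : ell2 R](scale0r 0) l2normZ ComplexField.Normc.normc0 mul0r.
move=> a S T /asboolP[linS [M SM]] /asboolP[linT [N TN]].
apply/asboolP; split=> [b x y|].
  rewrite -[LHS]/(a *: S (b *: x + y) + T (b *: x + y)) linS linT.
  rewrite -[RHS]/(b *: (a *: S x + T x) + (a *: S y + T y)).
  by rewrite !scalerDr !scalerA [b * a]mulrC addrACA.
exists (ComplexField.Normc.normc a * M + N) => x.
rewrite mulrDl; apply: le_trans (l2normD _ _) _; rewrite l2normZ.
by rewrite lerD// -mulrA ler_wpM2l// normc_ge0.
Qed.

HB.instance Definition _ (R : realType) := GRing.isSubmodClosed.Build _ _
  (@bounded_op R) (@bounded_op_submod R).

Definition bop (R : realType) := {T : ell2 R -> ell2 R | T \in bounded_op}.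

Section BoundedOperators.
Context {R : realType}.
Implicit Types S T U : bop R.
Local Notation normc := (@ComplexField.Normc.normc R).

HB.instance Definition _ := SubChoice.on (bop R).
HB.instance Definition _ := [SubChoice_isSubLmodule of bop R by <:].

Lemma bop_linear T : linear (val T).
Proof. by have [] := asboolW (valP T). Qed.

Lemma bop_bounded T :
  exists2 M : R, 0 < M & forall x, l2norm (val T x) <= M * l2norm x.
Proof.
have [_ [M TM]] := asboolW (valP T).
exists (`|M| + 1) => [|x]; first by rewrite ltr_wpDl.
apply: le_trans (TM x) _; rewrite ler_wpM2r ?l2norm_ge0//.
by rewrite (le_trans (ler_norm M))// lerDl.
Qed.

Lemma bopP S T : val S =1 val T -> S = T.
Proof. by move=> ST; apply: val_inj; apply/funext. Qed.

Lemma bop_addE S T x : val (S + T) x = val S x + val T x.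
Proof. by rewrite GRing.valD. Qed.

Lemma bop_id_subproof : idfun \in @bounded_op R.
Proof. by apply/asboolP; split=> //; exists 1 => x; rewrite mul1r. Qed.

Definition bop_one : bop R := Sub idfun bop_id_subproof.

Lemma bop_comp_subproof S T : (val S \o val T) \in @bounded_op R.
Proof.
apply/asboolP; split=> [a x y|]; first by rewrite /= !bop_linear.
have [M M0 SM] := bop_bounded S; have [N _ TN] := bop_bounded T.
exists (M * N) => x; rewrite -mulrA; apply: le_trans (SM _) _.
by rewrite ler_wpM2l// ltW.
Qed.

Definition bop_mul S T : bop R := Sub (val S \o val T) (bop_comp_subproof S T).

Let bop_mul_val S T x : val (bop_mul S T) x = val S (val T x).
Proof. by []. Qed.

Let bop_mulA : associative bop_mul.
Proof. by move=> S T U; apply: bopP. Qed.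

Let bop_mul1l : left_id bop_one bop_mul.
Proof. by move=> S; apply: bopP. Qed.

Let bop_mul1r : right_id bop_one bop_mul.
Proof. by move=> S; apply: bopP. Qed.

Let bop_mulDl : left_distributive bop_mul +%R.
Proof.
by move=> S T U; apply: bopP => x; rewrite [RHS]bop_addE !bop_mul_val bop_addE.
Qed.

Let bop_mulDr : right_distributive bop_mul +%R.
Proof.
move=> S T U; apply: bopP => x; rewrite [RHS]bop_addE !bop_mul_val bop_addE.
by have := bop_linear S 1 (val T x) (val U x); rewrite !scale1r.
Qed.

HB.instance Definition _ := GRing.Zmodule_isPzRing.Build (bop R)
  bop_mulA bop_mul1l bop_mul1r bop_mulDl bop_mulDr.

Lemma bop_mulE S T x : val (S * T) x = val S (val T x).
Proof. by []. Qed.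

Lemma bop_scaleE a T x : val (a *: T) x = a *: val T x.
Proof. by rewrite GRing.valZ. Qed.

Lemma bop_oneE x : val (1 : bop R) x = x.
Proof. by []. Qed.

Lemma bop0 T : val T 0 = 0.
Proof.
have := bop_linear T 1 0 0; rewrite scaler0 scale1r add0r => /eqP.
by rewrite eq_sym -subr_eq0 addrK => /eqP.
Qed.

Lemma bopB T x y : val T (x - y) = val T x - val T y.
Proof. by rewrite addrC -scaleN1r bop_linear scaleN1r addrC. Qed.

Lemma bopZ T a x : val T (a *: x) = a *: val T x.
Proof. by have := bop_linear T a x 0; rewrite bop0 !addr0. Qed.

Lemma bop_continuous T : continuous (val T).
Proof.
move=> x; have [M M0 TM] := bop_bounded T.
apply/(@cvgrPdist_lt _ _ _ (nbhs x) (nbhs_filter x)) => e e0.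
have Me0 : 0 < e / M%:C by rewrite divr_gt0// ltcR.
have := @cvgr_dist_lt _ _ _ (nbhs x) (nbhs_filter x) idfun x (@cvg_id _ _) _ Me0.
apply: (@filterS _ _ (nbhs_filter x)) => y.
rewrite ltr_pdivlMr ?ltcR// => lt.
rewrite -bopB normr_ell2E; apply: le_lt_trans lt.
by rewrite normr_ell2E -rmorphM lecR mulrC.
Qed.

(* sup of |T x| over the closed unit ball *)
Definition opnorm T : R := sup [set l2norm (val T x) | x in [set x | l2norm x <= 1]].

Definition is_adjoint T S := forall x y, dotl2 (val T x) y = dotl2 x (val S y).

Lemma adjoint_exists T : exists S, is_adjoint T S.
Proof.
have [M M0 TM] := bop_bounded T.
have bnd y : functional_bound (fun x => dotl2 (val T x) y) (M * l2norm y).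
  split; first by rewrite mulr_ge0 ?l2norm_ge0// ltW.
    by move=> a x z; rewrite bop_linear dotl2DZl.
  move=> x; apply: le_trans (dotl2_CS _ _) _.
  by rewrite mulrAC ler_wpM2r// l2norm_ge0.
pose f y := projT1 (cid (riesz (bnd y))).
have fE x y : dotl2 (val T x) y = dotl2 x (f y).
  by rewrite /f; case: cid => z /= ->.
have flin : linear f.
  by move=> a y z; apply: dotl2_inj => x; rewrite -fE !dotl2DZr !fE.
have fb : f \in bounded_op.
  apply/asboolP; split=> //; exists M => y.
  have [->|y0] := eqVneq (l2norm (f y)) 0; first by rewrite mulr_ge0 ?l2norm_ge0// ltW.
  have {}y0 : 0 < l2norm (f y) by rewrite lt_neqAle eq_sym y0 l2norm_ge0.
  rewrite -(ler_pM2l y0) -expr2 -[leLHS]ger0_norm ?sqr_ge0//.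
  have -> : `|l2norm (f y) ^+ 2| = normc (dotl2 (f y) (f y)).
    by rewrite dotl2xx /ComplexField.Normc.normc/= expr0n addr0 sqrtr_sqr.
  rewrite -fE; apply: le_trans (dotl2_CS _ _) _.
  by rewrite mulrA ler_wpM2r ?l2norm_ge0// mulrC.
by exists (Sub f fb) => x y; rewrite fE.
Qed.

Lemma adjoint_unique T S S' : is_adjoint T S -> is_adjoint T S' -> S = S'.
Proof. by move=> TS TS'; apply: bopP => y; apply: dotl2_inj => x; rewrite -TS -TS'. Qed.

Definition adjoint T : bop R := projT1 (cid (adjoint_exists T)).

Lemma adjointP T : is_adjoint T (adjoint T).
Proof. by rewrite /adjoint; case: cid. Qed.

Definition unit_ball : set (ell2 R) := [set x | l2norm x <= 1].

(* The image of the closed unit ball is relatively compact (precompact in the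
   library sense: its closure is compact). *)
Definition compact_op : {pred bop R} :=
  [pred T | `[< precompact (val T @` unit_ball) >]].

Lemma compact_op_sub T (A : set (ell2 R)) : compact A ->
  val T @` unit_ball `<=` A -> T \in compact_op.
Proof.
move=> cA TA; apply/asboolP; apply: precompact_subset TA _.
by apply: compact_precompact => //; exact: norm_hausdorff.
Qed.

Lemma compact_op_submod : submod_closed compact_op.
Proof.
split.
  apply: (@compact_op_sub _ [set 0]); first exact: compact_set1.
  by move=> _ [x _ <-].
move=> a S T /asboolP; rewrite precompactE => cS /asboolP; rewrite precompactE => cT.
apply: (@compact_op_sub _ [set a *: p.1 + p.2 |
  p in closure (val S @` unit_ball) `*` closure (val T @` unit_ball)]).
  apply: continuous_compact; last exact: compact_setX.
  apply: continuous_subspaceT => p.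
  apply: cvgD; last exact: cvg_snd.
  by apply: cvgZr; exact: cvg_fst.
move=> _ [x x1 <-]; exists (val S x, val T x); last first.
  by rewrite bop_addE bop_scaleE.
by split; apply: subset_closure; exists x.
Qed.

HB.instance Definition _ := GRing.isSubmodClosed.Build _ _
  compact_op compact_op_submod.

Lemma compact_opMl S T : T \in compact_op -> S * T \in compact_op.
Proof.
move=> /asboolP; rewrite precompactE => cT.
apply: (@compact_op_sub _ (val S @` closure (val T @` unit_ball))).
  by apply: continuous_compact => //; apply: continuous_subspaceT; exact: bop_continuous.
move=> _ [x x1 <-]; exists (val T x) => //.
by apply: subset_closure; exists x.
Qed.

Lemma compact_opMr S T : T \in compact_op -> T * S \in compact_op.
Proof.
have [M M0 SM] := bop_bounded S.
have MC0 : M%:C != 0 :> R[i] by rewrite gt_eqF// ltcR.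
move=> /asboolP; rewrite precompactE => cT.
apply: (@compact_op_sub _ [set M%:C *: y | y in closure (val T @` unit_ball)]).
  apply: continuous_compact => //; apply: continuous_subspaceT.
  exact: scaler_continuous.
move=> _ [x x1 <-]; exists (val T (M%:C^-1 *: val S x)); last first.
  by rewrite bopZ scalerA mulfV// scale1r.
apply: subset_closure; exists (M%:C^-1 *: val S x) => //.
rewrite /unit_ball/= l2normZ ComplexField.Normc.normcV.
have -> : normc M%:C = M.
  by apply: complexI; rewrite -normCE ger0_norm// lecR ltW.
rewrite mulrC ler_pdivrMr// mul1r; apply: le_trans (SM x) _.
by rewrite ler_piMr// ltW.
Qed.

End BoundedOperators.

Definition calkin (R : realType) : Type :=
  Quotient.quot (@compact_op R : zmodClosed (bop R)).

Section Calkin.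
Context {R : realType}.
Local Open Scope quotient_scope.
Implicit Types (S T : bop R) (p q : calkin R).

HB.instance Definition _ := Choice.on (calkin R).
HB.instance Definition _ := GRing.Zmodule.on (calkin R).

Definition to_calkin (T : bop R) : calkin R :=
  \pi_(Quotient.quot (@compact_op R : zmodClosed (bop R))) T.

Definition calkin_repr (q : calkin R) : bop R := repr q.

Lemma calkin_reprK q : to_calkin (calkin_repr q) = q.
Proof. exact: reprK. Qed.

Lemma to_calkin_eq S T : (to_calkin S = to_calkin T) <-> S - T \in compact_op.
Proof.
split=> [/eqP|ST]; first by rewrite -Quotient.idealrBE.
by apply/eqP; rewrite -Quotient.idealrBE.
Qed.

Lemma to_calkin_repr T : calkin_repr (to_calkin T) - T \in compact_op.
Proof. by apply/to_calkin_eq; exact: calkin_reprK. Qed.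

Lemma to_calkinD S T : to_calkin (S + T) = to_calkin S + to_calkin T.
Proof. exact: Quotient.pi_add. Qed.

Definition calkin_one : calkin R := to_calkin 1.

Definition calkin_mul p q : calkin R :=
  to_calkin (calkin_repr p * calkin_repr q).

Definition calkin_scale (a : R[i]) q : calkin R :=
  to_calkin (a *: calkin_repr q).

Lemma to_calkinM S T : to_calkin (S * T) = calkin_mul (to_calkin S) (to_calkin T).
Proof.
apply/esym/to_calkin_eq.
set S' := calkin_repr _; set T' := calkin_repr _.
have -> : S' * T' - S * T = (S' - S) * T' + S * (T' - T).
  by rewrite mulrBl mulrBr addrA subrK.
apply: rpredD; first by apply: compact_opMr; exact: to_calkin_repr.
by apply: compact_opMl; exact: to_calkin_repr.
Qed.

Lemma to_calkinZ a T : to_calkin (a *: T) = calkin_scale a (to_calkin T).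
Proof.
by apply/esym/to_calkin_eq; rewrite -scalerBr rpredZ ?to_calkin_repr.
Qed.

Let calkin_ind (P : calkin R -> Prop) : (forall T, P (to_calkin T)) ->
  forall q, P q.
Proof. by move=> H q; rewrite -(calkin_reprK q). Qed.

Let calkin_mulA : associative calkin_mul.
Proof.
elim/calkin_ind => S; elim/calkin_ind => T; elim/calkin_ind => U.
by rewrite -!to_calkinM mulrA.
Qed.

Let calkin_mul1l : left_id calkin_one calkin_mul.
Proof. by elim/calkin_ind => S; rewrite -to_calkinM mul1r. Qed.

Let calkin_mul1r : right_id calkin_one calkin_mul.
Proof. by elim/calkin_ind => S; rewrite -to_calkinM mulr1. Qed.

Let calkin_mulDl : left_distributive calkin_mul +%R.
Proof.
elim/calkin_ind => S; elim/calkin_ind => T; elim/calkin_ind => U.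
by rewrite -to_calkinD -!to_calkinM mulrDl to_calkinD.
Qed.

Let calkin_mulDr : right_distributive calkin_mul +%R.
Proof.
elim/calkin_ind => S; elim/calkin_ind => T; elim/calkin_ind => U.
by rewrite -to_calkinD -!to_calkinM mulrDr to_calkinD.
Qed.

HB.instance Definition _ := GRing.Zmodule_isPzRing.Build (calkin R)
  calkin_mulA calkin_mul1l calkin_mul1r calkin_mulDl calkin_mulDr.

Let calkin_scaleA a b q :
  calkin_scale a (calkin_scale b q) = calkin_scale (a * b) q.
Proof. by elim/calkin_ind: q => T; rewrite -!to_calkinZ scalerA. Qed.

Let calkin_scale1 : left_id 1 calkin_scale.
Proof. by elim/calkin_ind => T; rewrite -!to_calkinZ scale1r. Qed.

Let calkin_scaleDr : right_distributive calkin_scale +%R.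
Proof.
move=> a; elim/calkin_ind => S; elim/calkin_ind => T.
by rewrite -to_calkinD -!to_calkinZ scalerDr to_calkinD.
Qed.

Let calkin_scaleDl q : {morph calkin_scale^~ q : a b / a + b}.
Proof.
by move=> a b; elim/calkin_ind: q => T; rewrite -!to_calkinZ scalerDl to_calkinD.
Qed.

HB.instance Definition _ := GRing.Zmodule_isLmodule.Build R[i] (calkin R)
  calkin_scaleA calkin_scale1 calkin_scaleDr calkin_scaleDl.

(* The choice of representative is immaterial, adjoints of compact operators
   being compact. *)
Definition calkin_star q : calkin R := to_calkin (adjoint (calkin_repr q)).

(* Quotient norm: the distance of a lift of q to the compact operators. *)
Definition calkin_norm q : R := inf [set opnorm T | T in to_calkin @^-1` [set q]].

(* Norm-closed *-subalgebras; they are not required to contain the unit. *)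
Record cstar_subalgebra (A : set (calkin R)) : Prop := {
  cstar_subalgebra0 : A 0;
  cstar_subalgebraD : forall a b, A a -> A b -> A (a + b);
  cstar_subalgebraZ : forall (z : R[i]) a, A a -> A (z *: a);
  cstar_subalgebraM : forall a b, A a -> A b -> A (a * b);
  cstar_subalgebra_star : forall a, A a -> A (calkin_star a);
  cstar_subalgebra_closed : forall a,
    (forall e : R, 0 < e -> exists2 b, A b & calkin_norm (a - b) < e) -> A a
}.

Definition commutative_cstar_subalgebra (A : set (calkin R)) : Prop :=
  cstar_subalgebra A /\ (forall a b, A a -> A b -> a * b = b * a).

Definition masa (A : set (calkin R)) : Prop :=
  commutative_cstar_subalgebra A /\
  (forall B, commutative_cstar_subalgebra B -> A `<=` B -> B = A).

End Calkin.

Section ContinuousFunctions.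
Context (R : realType) (K : topologicalType).

(* The *-algebra C(K), with pointwise operations. K may be empty, hence
   possibly-zero (Pz) rings are used throughout. *)
Definition CK : Type := continuousType K R[i].

HB.instance Definition _ := Choice.on CK.

Implicit Types f g h : CK.
Local Notation fn f := (f : continuousType K R[i]).

Let ck_zero : CK := cst (0 : R[i]).
Let ck_one : CK := cst (1 : R[i]).

Lemma ck_add_cts f g : continuous (fun x => fn f x + fn g x).
Proof. by move=> x; apply: cvgD; exact: cts_fun. Qed.
Let ck_add f g : CK := mkcts (@ck_add_cts f g).

Lemma ck_mul_cts f g : continuous (fun x => fn f x * fn g x).
Proof. by move=> x; apply: cvgM; exact: cts_fun. Qed.
Let ck_mul f g : CK := mkcts (@ck_mul_cts f g).

Lemma ck_opp_cts f : continuous (fun x => - fn f x).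
Proof. by move=> x; apply: cvgN; exact: cts_fun. Qed.
Let ck_opp f : CK := mkcts (@ck_opp_cts f).

Lemma ck_scale_cts (a : R[i]) f : continuous (fun x => a * fn f x).
Proof. by move=> x; apply: cvgMr; exact: cts_fun. Qed.
Let ck_scale a f : CK := mkcts (@ck_scale_cts a f).

Lemma ck_star_cts f : continuous (fun x => (fn f x)^*).
Proof.
move=> x; apply/cvgrPdist_lt => e e0.
have /cvgrPdist_lt := @cts_fun _ _ (fn f) x => /(_ _ e0).
by apply: filterS => y; rewrite -rmorphB normcJ.
Qed.
Definition ck_star f : CK := mkcts (@ck_star_cts f).

Lemma ckP f g : (forall x, fn f x = fn g x) -> f = g.
Proof. by move=> fg; apply/continuousEP. Qed.

Let ck_addA : associative ck_add.
Proof. by move=> f g h; apply: ckP => x; exact: addrA. Qed.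
Let ck_addC : commutative ck_add.
Proof. by move=> f g; apply: ckP => x; exact: addrC. Qed.
Let ck_add0 : left_id ck_zero ck_add.
Proof. by move=> f; apply: ckP => x; exact: add0r. Qed.
Let ck_addN : left_inverse ck_zero ck_opp ck_add.
Proof. by move=> f; apply: ckP => x; exact: addNr. Qed.

HB.instance Definition _ := GRing.isZmodule.Build CK
  ck_addA ck_addC ck_add0 ck_addN.

Let ck_mulA : associative ck_mul.
Proof. by move=> f g h; apply: ckP => x; exact: mulrA. Qed.
Let ck_mulC : commutative ck_mul.
Proof. by move=> f g; apply: ckP => x; exact: mulrC. Qed.
Let ck_mul1 : left_id ck_one ck_mul.
Proof. by move=> f; apply: ckP => x; exact: mul1r. Qed.
Let ck_mulDl : left_distributive ck_mul +%R.
Proof. by move=> f g h; apply: ckP => x; exact: mulrDl. Qed.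

HB.instance Definition _ := GRing.Zmodule_isComPzRing.Build CK
  ck_mulA ck_mulC ck_mul1 ck_mulDl.

Let ck_scaleA a b f : ck_scale a (ck_scale b f) = ck_scale (a * b) f.
Proof. by apply: ckP => x; exact: mulrA. Qed.
Let ck_scale1 : left_id 1 ck_scale.
Proof. by move=> f; apply: ckP => x; exact: mul1r. Qed.
Let ck_scaleDr : right_distributive ck_scale +%R.
Proof. by move=> a f g; apply: ckP => x; exact: mulrDr. Qed.
Let ck_scaleDl f : {morph ck_scale^~ f : a b / a + b}.
Proof. by move=> a b; apply: ckP => x; exact: mulrDl. Qed.

HB.instance Definition _ := GRing.Zmodule_isLmodule.Build R[i] CK
  ck_scaleA ck_scale1 ck_scaleDr ck_scaleDl.

(* A *-isomorphism of C(K) onto A; preservation of units is not required, and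
   isometry is automatic. *)
Definition star_isomorphic_to (A : set (calkin R)) : Prop :=
  exists F : {linear CK -> calkin R}, [/\ {morph F : f g / f * g},
    {morph F : f / ck_star f >-> calkin_star f} & set_bij setT A F].

End ContinuousFunctions.

(* Cardinals are represented by sets and compared with #<=. least_card P is a
   member of P of least cardinality, which exists by least_card_exists as soon
   as P is nonempty. *)
Definition is_least_card T (P : set (set T)) (A : set T) : Prop :=
  P A /\ forall B, P B -> A #<= B.

Lemma least_card_exists T (P : set (set T)) :
  P !=set0 -> exists A, is_least_card P A.
Proof.
move=> [A0 PA0].
have [[t0]|noT] := pselect (inhabited T); last first.
  exists A0; split=> // B _; rewrite (_ : A0 = set0) ?card_ge0//.
  by apply/seteqP; split=> // t; case: noT; exists.
pose choice (f : set T -> T) := forall A, P A -> A (f A).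
pose Q (S : set (set T -> T)) := S `<=` choice /\
  forall f g, S f -> S g -> f <> g -> forall A, P A -> f A <> g A.
have [|S [[Schoice Sinj] Smax]] := @Zorn_bigcup _ Q.
  move=> F FQ Ftot; split=> [f [S FS Sf]|f g [S FS Sf] [S' FS' S'g]].
    exact: (FQ _ FS).1.
  have [SS'|S'S] := Ftot _ _ FS FS'.
    by apply: (FQ _ FS').2 => //; exact: SS'.
  by apply: (FQ _ FS).2 => //; exact: S'S.
have [[A PA AS]|noA] :=
    pselect (exists2 A, P A & forall a, A a -> exists2 f, S f & f A = a).
  exists A; split=> // B PB.
  have gP a : exists f : set T -> T, A a -> S f /\ f A = a.
    have [Aa|nAa] := pselect (A a); last by exists (fun=> t0) => /nAa.
    by have [f Sf fA] := AS a Aa; exists f => _; split.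
  pose g a := projT1 (cid (gP a)).
  have gS a : A a -> S (g a) /\ g a A = a by rewrite /g; case: cid.
  pose h a := g a B.
  have hinj : {in A &, injective h}.
    move=> a b /set_mem Aa /set_mem Ab hab.
    have [Sa <-] := gS a Aa; have [Sb <-] := gS b Ab.
    have [->//|ab] := pselect (g a = g b).
    by have := Sinj _ _ Sa Sb ab B PB.
  have hB : h @` A `<=` B.
    by move=> _ [a Aa <-]; have [Sga _] := gS a Aa; exact: (Schoice _ Sga B PB).
  apply: card_le_trans (subset_card_le hB).
  by have /card_eqPle[] := inj_card_eq hinj.
have miss A : exists a, P A -> A a /\ forall f, S f -> f A <> a.
  have [PA|nPA] := pselect (P A); last by exists t0 => /nPA.
  apply: contrapT => noa; apply: noA; exists A => // a Aa.
  apply: contrapT => nof; apply: noa; exists a => _; split=> // f Sf fA.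
  by apply: nof; exists f.
pose f A := projT1 (cid (miss A)).
have fP A : P A -> A (f A) /\ forall g, S g -> g A <> f A.
  by rewrite /f; case: cid.
have Sf : ~ S f by move=> Sf; have [_ /(_ f Sf)] := fP _ PA0.
have [] := Smax (S `|` [set f]).
  by split=> [g Sg|/(_ f) sub]; [left|apply: Sf; apply: sub; right].
split=> [g [Sg|->]|g h [Sg|->] [Sh|->] gh A PA].
- exact: Schoice.
- by move=> A PA; exact: (fP A PA).1.
- exact: Sinj.
- exact: (fP A PA).2.
- by move=> fh; exact: ((fP A PA).2 h Sh).
- by [].
Qed.

Definition least_card T (P : set (set T)) : set T := get (is_least_card P).

Lemma least_cardP T (P : set (set T)) :
  P !=set0 -> is_least_card P (least_card P).
Proof.
by move=> /least_card_exists [A PA]; apply: (@getPex _ (is_least_card P)); exists A.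
Qed.

Definition nbhs_basis (K : topologicalType) (x : K) (B : set (set K)) : Prop :=
  B `<=` nbhs x /\ filter_from B id --> x.

(* The character of x, as a cardinal: the size of a chosen neighbourhood basis
   of least cardinality. *)
Definition character (K : topologicalType) (x : K) : set (set K) :=
  least_card (nbhs_basis x).

Lemma characterP (K : topologicalType) (x : K) :
  is_least_card (nbhs_basis x) (character x).
Proof.
apply: least_cardP; exists (nbhs x); split=> // U xU; by exists U.
Qed.

Definition centered_family (F : set (set nat)) : Prop :=
  forall G : set (set nat), G `<=` F -> finite_set G -> G !=set0 ->
    infinite_set (\bigcap_(A in G) A).

Definition pseudointersection (F : set (set nat)) (X : set nat) : Prop :=
  infinite_set X /\ forall A, F A -> finite_set (X `\` A).

Definition no_pseudointersection_family (F : set (set nat)) : Prop :=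
  [/\ (forall A, F A -> infinite_set A), centered_family F &
    ~ exists X, pseudointersection F X].

(* The cardinal p, likewise. *)
Definition pseudointersection_number : set (set nat) :=
  least_card no_pseudointersection_family.

Lemma pseudointersection_numberP :
  is_least_card no_pseudointersection_family pseudointersection_number.
Proof.
apply: least_cardP.
have [U [UU oU]] := ultraFilterLemma (@eventually_filter).
have Uinf A : U A -> infinite_set A.
  move=> UA /finite_fsetP[X AX].
  have UX : U (\bigcap_(i in [set` X]) ~` [set i]).
    apply: filter_bigI => i _; apply: oU; exists i.+1 => // n /= ni ein.
    by rewrite ein ltnn in ni.
  have : U set0.
    apply: filterS (filterI UA UX) => n [An nX].
    by rewrite AX in An; exact: (nX n An).
  exact: filter_not_empty.
exists U; split => [A /Uinf//|G GU /finite_fsetP[X GX] _|[X [Xinf UX]]].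
  apply: Uinf; rewrite GX; apply: filter_bigI => A AX.
  by apply: GU; rewrite GX.
have /infiniteP/pcard_leP[f] := Xinf.
have fX n : X (f n) by exact: (@funS _ _ _ _ f).
have fI m n : f m = f n -> m = n by apply: (@inj _ _ _ f); rewrite inE.
have rinf (e : nat -> nat) : injective e -> infinite_set (range (f \o e)).
  move=> eI; apply/infiniteP.
  have : {in [set: nat] &, injective (f \o e)} by move=> m n _ _ /fI/eI.
  by move=> /inj_card_eq/card_eqPle[].
pose E := range (f \o double).
have [UE|UE] := in_ultra_setVsetC E UU.
  apply: (rinf (fun n => n.*2.+1)); first by move=> m n [] /double_inj.
  apply: sub_finite_set (UX _ UE) => _ [n _ <-]; split; first exact: fX.
  by move=> [m _ /fI/(congr1 odd)] /=; rewrite !odd_double.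
apply: (rinf double); first exact: double_inj.
apply: sub_finite_set (UX _ UE) => _ [n _ <-]; split; first exact: fX.
by move=> /(_ (imageP _ _)); apply.
Qed.

(* Main.v *)
(* Suppose that a masa A is isomorphic to C(K) by F and that x has a neighbourhood
   basis B of fewer than p sets. For U in B choose f_U in C(K), equal to 1 near x
   and to 0 off U. The set A_U of finitely supported rational vectors v such that
   |(1 - F(f_U)) v| <= 2^-n |v|, where the support of v starts at n, meets every
   finite intersection of such sets arbitrarily far out, because F(h) is not
   compact when h(x) = 1. A pseudointersection of the A_U yields an isometry V
   with F(f_U) V = V modulo compact operators for all U in B, hence
   F(g) V = g(x) V for all g. Then V D V^* commutes with A, hence lies in A, for
   every self-adjoint D; so V D V^* = F(g) for some g, and D = g(x) modulo compact
   operators. A diagonal projection of infinite rank and corank contradicts this. *)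
Require Import Defs.
From mathcomp Require Import all_boot all_order all_algebra.
From mathcomp Require Import complex ring lra.
From mathcomp Require Import all_classical all_reals all_analysis.

Set Implicit Arguments.
Unset Strict Implicit.
Unset Printing Implicit Defensive.

Import Order.TTheory GRing.Theory Num.Theory.
Import numFieldNormedType.Exports.

Local Open Scope classical_set_scope.
Local Open Scope ring_scope.
Local Open Scope complex_scope.
Local Open Scope card_scope.

(** * Vectors of [ell2]: norms, inner products, tails *)

Section EllTwo.
Context {R : realType}.
Local Notation normc := (@ComplexField.Normc.normc R).
Implicit Types (v w x y : ell2 R) (T S : bop R).

Lemma l2norm0 : l2norm (0 : ell2 R) = 0.
Proof. by rewrite -(scale0r 0) l2normZ ComplexField.Normc.normc0 mul0r. Qed.

Lemma l2normN v : l2norm (- v) = l2norm v.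
Proof.
rewrite -scaleN1r l2normZ -[RHS]mul1r; congr (_ * _).
by apply: complexI; rewrite -normCE normrN1.
Qed.

Lemma l2normB v w : l2norm (v - w) <= l2norm v + l2norm w.
Proof. by rewrite -(l2normN w) l2normD. Qed.

Lemma l2norm_distC v w : l2norm (v - w) = l2norm (w - v).
Proof. by rewrite -l2normN opprB. Qed.

Lemma l2norm_gt0 v : v != 0 -> 0 < l2norm v.
Proof.
by move=> v0; rewrite lt_neqAle l2norm_ge0 andbT eq_sym; apply: contra_neq v0 => /l2norm_eq0.
Qed.

Lemma normc_real (a : R) : normc a%:C = `|a|.
Proof. by rewrite /ComplexField.Normc.normc/= expr0n addr0 sqrtr_sqr. Qed.

Lemma bopD T v w : val T (v + w) = val T v + val T w.
Proof. by have := bop_linear T 1 v w; rewrite !scale1r. Qed.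

Lemma bop_oppE T v : val (- T) v = - val T v.
Proof. by rewrite GRing.valN. Qed.

Lemma bop_subE T S v : val (T - S) v = val T v - val S v.
Proof. by rewrite bop_addE bop_oppE. Qed.

Lemma val_addE v w k : val (v + w) k = val v k + val w k.
Proof. by rewrite GRing.valD. Qed.

Lemma val_oppE v k : val (- v) k = - val v k.
Proof. by rewrite GRing.valN. Qed.

Lemma val_scaleE a v k : val (a *: v) k = a * val v k.
Proof. by rewrite GRing.valZ. Qed.

Lemma val_truncE N u k : val (trunc N u : ell2 R) k = if (k < N)%N then u k else 0.
Proof. by []. Qed.

Lemma ell2P v w : val v =1 val w -> v = w.
Proof. by move=> vw; apply: val_inj; apply/funext. Qed.

Lemma dotl2Dl x y w : dotl2 (x + y) w = dotl2 x w + dotl2 y w.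
Proof. by rewrite -[x]scale1r dotl2DZl mul1r scale1r. Qed.

Lemma dotl2Zl a x w : dotl2 (a *: x) w = a * dotl2 x w.
Proof. by rewrite -[a *: x]addr0 dotl2DZl dotl20l addr0. Qed.

Lemma dotl2Nl x w : dotl2 (- x) w = - dotl2 x w.
Proof. by rewrite -scaleN1r dotl2Zl mulN1r. Qed.

Lemma dotl2Dr x y w : dotl2 x (y + w) = dotl2 x y + dotl2 x w.
Proof. by rewrite -[y]scale1r dotl2DZr rmorph1 mul1r scale1r. Qed.

Lemma dotl2Zr a x w : dotl2 x (a *: w) = a^* * dotl2 x w.
Proof. by rewrite -[a *: w]addr0 dotl2DZr dotl20r addr0. Qed.

Lemma dotl2Nr x w : dotl2 x (- w) = - dotl2 x w.
Proof. by rewrite -scaleN1r dotl2Zr rmorphN1 mulN1r. Qed.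

Lemma dotl2_delta v k : dotl2 v (delta k) = val v k.
Proof.
apply: cvg_lim; first exact: norm_hausdorff.
apply: cvg_near_cst; exists k.+1 => // n /= kn.
rewrite /series/= (bigD1_seq k) ?iota_uniq ?mem_index_iota//=.
rewrite big1 ?addr0 /dotseq.
  by rewrite val_delta eqxx rmorph1 mulr1.
by move=> i ik; rewrite val_delta (negPf ik) rmorph0 mulr0.
Qed.

Lemma l2norm_coord v k : normc (val v k) <= l2norm v.
Proof.
have s0 := sqabs_ge0 (val v).
rewrite -ler_sqr ?nnegrE ?l2norm_ge0 ?normc_ge0// l2norm_sqr.
apply: (@le_trans _ _ (series (sqabs (val v)) k.+1)).
  by rewrite /series/= big_nat_recr//= lerDr; apply: sumr_ge0.
exact: series_le_limn k.+1 s0 (@ell2_cvg _ v).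
Qed.

Lemma l2norm_delta k : l2norm (delta k : ell2 R) = 1.
Proof.
have : l2norm (delta k : ell2 R) ^+ 2 = 1.
  apply: complexI; rewrite -dotl2xx dotl2_delta val_delta eqxx//.
move/eqP; rewrite sqrf_eq1 => /orP[/eqP//|/eqP e].
by have := l2norm_ge0 (delta k : ell2 R); rewrite e; lra.
Qed.

Lemma le_l2norm_trunc N v : l2norm (trunc N (val v)) <= l2norm v.
Proof.
rewrite -ler_sqr ?nnegrE ?l2norm_ge0// l2norm_trunc_sqr l2norm_sqr.
exact: series_le_limn N (sqabs_ge0 _) (@ell2_cvg _ v).
Qed.

Definition tail (N : nat) v := forall k, (k < N)%N -> val v k = 0.

Lemma tail_delta n : tail n (delta n).
Proof. by move=> k kn; rewrite val_delta ltn_eqF. Qed.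

Lemma tail_le m n v : (m <= n)%N -> tail n v -> tail m v.
Proof. by move=> mn tv k km; apply: tv; exact: leq_trans km mn. Qed.

Lemma tail_subtrunc N v : tail N (v - trunc N (val v)).
Proof. by move=> k kN; rewrite val_addE val_oppE val_truncE kN subrr. Qed.

Lemma tailZ N a v : tail N v -> tail N (a *: v).
Proof. by move=> tv k kN; rewrite val_scaleE tv// mulr0. Qed.

Lemma normc_dotl2_tail N v y : tail N v ->
  normc (dotl2 v y) <= l2norm v * l2norm (y - trunc N (val y)).
Proof.
move=> tv; suff -> : dotl2 v y = dotl2 v (y - trunc N (val y)) by exact: dotl2_CS.
congr (limn (series _)); apply/funext => k; rewrite /dotseq val_addE val_oppE val_truncE.
by case: ltnP => [/tv->|_]; rewrite ?mul0r// subr0.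
Qed.

Lemma dotl2_tail_small y (e : R) : 0 < e ->
  exists N, forall v, tail N v -> normc (dotl2 v y) <= e * l2norm v.
Proof.
move=> e0; have /cvgrPdist_lt/(_ _ e0)[N _ /(_ N (leqnn _))] := @cvg_trunc _ y.
rewrite sub0r normrN ger0_norm ?l2norm_ge0// => le; exists N => v tv.
apply: le_trans (normc_dotl2_tail y tv) _.
by rewrite mulrC ler_wpM2r ?l2norm_ge0// ltW.
Qed.

(** The working form of compactness: the norm of [T] on vectors supported from [N] on tends to 0 as
    [N] grows. Its equivalence with [compact_op] is [compact_opE]. *)
Definition tail_small T := forall e : R, 0 < e ->
  exists N, forall v, tail N v -> l2norm (val T v) <= e * l2norm v.

End EllTwo.

(** * Compact operators and adjoints *)

Section Compactness.
Context {R : realType}.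
Local Notation normc := (@ComplexField.Normc.normc R).
Implicit Types (v w x y : ell2 R) (T S : bop R).

Lemma near_l2norm y (e : R) : 0 < e -> \forall w \near y, l2norm (y - w) < e.
Proof.
move=> e0; have eC : 0 < e%:C :> R[i] by rewrite ltcR.
have := @cvgr_dist_lt _ _ _ (nbhs y) (nbhs_filter y) idfun y (@cvg_id _ _) _ eC.
apply: (@filterS _ _ (nbhs_filter y)) => w.
by rewrite normr_ell2E ltcR.
Qed.

Lemma ler_dist_normc (a b : R[i]) : `|normc a - normc b| <= normc (a - b).
Proof.
have := le_normcD (a - b) b; rewrite subrK => h1.
have := le_normcD (b - a) a; rewrite subrK => h2.
have h3 : normc (b - a) = normc (a - b) by apply: complexI; rewrite -!normCE distrC.
by rewrite ler_norml; apply/andP; split; lra.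
Qed.

Lemma normcB_continuous (c : R[i]) : continuous (fun a : R[i] => normc (a - c)).
Proof.
move=> a; apply/(@cvgrPdist_lt _ _ _ (nbhs a) (nbhs_filter a)) => e e0.
have eC : 0 < e%:C :> R[i] by rewrite ltcR.
have := @cvgr_dist_lt _ _ _ (nbhs a) (nbhs_filter a) idfun a (@cvg_id _ _) _ eC.
apply: (@filterS _ _ (nbhs_filter a)) => b; rewrite normCE ltcR; apply: le_lt_trans.
apply: le_trans (ler_dist_normc _ _) _; rewrite le_eqVlt; apply/orP; left; apply/eqP.
by congr normc; rewrite /=; ring.
Qed.

Lemma continuous_series (Y : topologicalType) (f : nat -> Y -> R) N :
  (forall k, continuous (f k)) -> continuous (fun u => series (f^~ u) N).
Proof.
move=> cf u; elim: N => [|N IH].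
  rewrite (_ : (fun _ => _) = cst 0); first exact: cvg_cst.
  by apply/funext => z; rewrite /series/= big_geq.
rewrite (_ : (fun _ => _) = (fun z => series (f^~ z) N + f N z)); last first.
  by apply/funext => z; rewrite /series/= big_nat_recr.
exact: (cvgD IH (cf N u)).
Qed.

(** Coordinatewise convergence; on bounded subsets of [ell2] this is the weak topology. *)
Let X := prod_topology (fun _ : nat => R[i]).

Lemma continuous_partial_sqnorm (a : nat -> R[i]) N :
  continuous (fun u : X => series (fun k => normc (u k - a k) ^+ 2) N : R).
Proof.
apply: (@continuous_series X (fun k u => normc (u k - a k) ^+ 2)) => k u.
have c : (fun w : X => normc (w k - a k)) @ u --> normc (u k - a k).
  exact: (@cvg_comp _ _ _ (fun w : X => w k) _ _ _ _ (@proj_continuous _ (fun=> R[i]) k u)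
    (@normcB_continuous (a k) (u k))).
exact: (cvgM c c).
Qed.

(** By Tychonoff the power of the square [D], which contains the unit disc, is compact; the box is a
    closed subset of it. *)
Lemma compact_unit_box : compact [set u : X | forall n, normc (u n) <= 1].
Proof.
pose D : set R[i] := [set p.1%:C + 'i%C * p.2%:C | p in `[-1, 1] `*` `[-1, 1]].
have cD : compact D.
  apply: continuous_compact; last by apply: compact_setX; exact: segment_compact.
  apply: continuous_subspaceT => p.
  have cC : continuous (fun t : R => t%:C : R[i]).
    move=> t; apply/(@cvgrPdist_lt _ _ _ (nbhs t) (nbhs_filter t)) => e.
    rewrite ltcE/= => /andP[/eqP e0 epos].
    have := @cvgr_dist_lt _ _ _ (nbhs t) (nbhs_filter t) idfun t (@cvg_id _ _) _ epos.
    by apply: (@filterS _ _ (nbhs_filter t)) => s; rewrite -rmorphB normCE normc_real ltcE/= e0 eqxx.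
  apply: cvgD; first by exact: (@cvg_comp _ _ _ (fun q : R * R => q.1) _ _ _ _ cvg_fst (cC p.1)).
  apply: cvgMr; exact: (@cvg_comp _ _ _ (fun q : R * R => q.2) _ _ _ _ cvg_snd (cC p.2)).
have cB := @tychonoff nat (fun=> R[i]) (fun=> D) (fun=> cD).
have -> : [set u : X | forall n, normc (u n) <= 1] =
  [set u : X | forall n, D (u n)] `&` (\bigcap_n [set u : X | normc (u n) <= 1]).
  apply/seteqP; split=> u /=; last by move=> [_ h] n; exact: h.
  move=> h; split=> // n; last by move=> _; exact: h.
  exists (complex.Re (u n), complex.Im (u n)); last by rewrite -complexE.
  have := h n; case: (u n) => a b /= ab; split=> /=; rewrite in_itv/= -ler_norml;
    apply: le_trans ab; rewrite -[leLHS]sqrtr_sqr ler_wsqrtr//.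
    by rewrite lerDl sqr_ge0.
  by rewrite lerDr sqr_ge0.
apply: compact_closedI => //; apply: closed_bigI => n _.
apply: (@closed_comp _ _ (fun u : X => normc (u n)) [set t | t <= 1]); last exact: closed_le.
move=> u _; have := @normcB_continuous 0 (u n).
rewrite (_ : (fun _ => _) = normc); last by apply/funext => z; rewrite subr0.
exact: (@cvg_comp _ _ _ (fun w : X => w n) _ _ _ _ (@proj_continuous _ (fun=> R[i]) n u)).
Qed.

(** The ball is cut out of the box by conditions on partial sums, because these are continuous in
    the product topology while the full norm is not. *)
Lemma compact_unit_sqball :
  compact [set u : X | forall n, series (sqabs u) n <= 1].
Proof.
have -> : [set u : X | forall n, series (sqabs u) n <= 1] =
  [set u : X | forall n, normc (u n) <= 1] `&`
  (\bigcap_n [set u : X | series (sqabs u) n <= 1]).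
  apply/seteqP; split=> u /=; last by move=> [_ h] n; exact: h.
  move=> h; split=> // n; last by move=> _; exact: h.
  rewrite -(@expr_le1 _ 2) ?normc_ge0//; have := h n.+1.
  rewrite /series/= big_nat_recr//= /sqabs; apply: le_trans; rewrite lerDr.
  by apply: sumr_ge0 => k _; exact: sqr_ge0.
apply: compact_closedI; first exact: compact_unit_box.
apply: closed_bigI => n _.
apply: (@closed_comp _ _ (fun u : X => series (sqabs u) n) [set t | t <= 1]); last exact: closed_le.
move=> u _; have := @continuous_partial_sqnorm (fun=> 0) n u.
rewrite (_ : (fun _ => _) = (fun w : X => series (sqabs w) n))//.
apply/funext => w; rewrite /series/=; apply: eq_bigr => k _.
by rewrite subr0.
Qed.

(** The unit ball is compact for coordinatewise convergence, and [T] is continuous from there to the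
    norm topology: finitely many coordinates control the head of a vector, and [T] is small on its
    tail. *)
Lemma tail_small_compact T : tail_small T -> T \in compact_op.
Proof.
move=> sT; have [M M0 TM] := bop_bounded T.
pose B := [set u : X | forall n, series (sqabs u) n <= 1].
have Bs (u : X) : B u -> u \in square_summable.
  by move=> Bu; apply/asboolP; exact: (bounded_series_cvg (sqabs_ge0 _) Bu).1.
(* The default 0 is never met on [B], whose members are square summable. *)
pose E (u : X) : ell2 R := insubd 0 (u : nat -> R[i]).
have EK (u : X) : B u -> val (E u) = u by move=> /Bs us; rewrite insubdK.
have E1 (u : X) : B u -> l2norm (E u) <= 1.
  move=> Bu; rewrite -[leRHS]sqrtr1 /l2norm ler_wsqrtr// EK//.
  exact: (bounded_series_cvg (sqabs_ge0 _) Bu).2.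
apply: (@compact_op_sub _ _ ((fun u => val T (E u)) @` B)); last first.
  move=> _ [x x1 <-]; exists (val x); last by rewrite /E valKd.
  move=> n; apply: (le_trans (series_le_limn n (sqabs_ge0 _) (@ell2_cvg _ x))).
  rewrite -[limn _]/(sqnorm (val x)) -l2norm_sqr expr_le1 ?l2norm_ge0//.
apply: continuous_compact; last exact: compact_unit_sqball.
apply/subspace_continuousP => u Bu.
apply/cvgrPdist_lt => e; rewrite ltcE/= => /andP[/eqP e0 epos].
(* The difference of two points of the ball has norm at most 2 and its tail at most 4, so the tail
   contributes at most e/2; a head below e/(4M) contributes less than e/4. *)
have e8 : 0 < complex.Re e / 8 by rewrite divr_gt0.
have [N TN] := sT _ e8.
have d0 : 0 < complex.Re e / (4 * M) by rewrite divr_gt0// mulr_gt0.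
have d20 : 0 < (complex.Re e / (4 * M)) ^+ 2 by rewrite exprn_gt0.
have /cvgrPdist_lt/(_ _ d20) := @continuous_partial_sqnorm u N u.
rewrite /within/=; apply: (@filterS _ _ (nbhs_filter u)) => w /=.
set su := series _ N; have -> : su = 0.
  by rewrite /su /series/= big1// => k _; rewrite subrr ComplexField.Normc.normc0 expr0n.
rewrite sub0r normrN => lt Bw.
rewrite -bopB normr_ell2E ltcE/= e0 eqxx/=.
have z2 : l2norm (E u - E w) <= 1 + 1.
  by apply: (le_trans (l2normB _ _)); exact: lerD (E1 _ Bu) (E1 _ Bw).
have [z zE] : exists z, z = E u - E w by exists (E u - E w).
rewrite -zE in z2 *.
have dz : l2norm (trunc N (val z)) < complex.Re e / (4 * M).
  rewrite -ltr_sqr ?nnegrE ?l2norm_ge0 ?(ltW d0)// l2norm_trunc_sqr.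
  apply: le_lt_trans lt; rewrite ger0_norm; last by apply: sumr_ge0 => k _; exact: sqr_ge0.
  rewrite le_eqVlt; apply/orP; left; apply/eqP; apply: eq_bigr => k _.
  rewrite /sqabs zE val_addE val_oppE !EK//; congr (_ ^+ 2).
  by apply: complexI; rewrite -!normCE distrC.
rewrite -(subrK (trunc N (val z)) z) bopD; apply: le_lt_trans (l2normD _ _) _.
have h1 := TN _ (@tail_subtrunc _ N z).
have h2 := TM (trunc N (val z)).
have h3 := l2normB z (trunc N (val z)); have h4 := le_l2norm_trunc N z.
have h5 : M * l2norm (trunc N (val z)) < complex.Re e / 4.
  rewrite mulrC -ltr_pdivlMr//; apply: lt_le_trans dz _.
  by rewrite le_eqVlt; apply/orP; left; apply/eqP; field; rewrite gt_eqF.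
have h6 : complex.Re e / 8 * l2norm (z - trunc N (val z)) <= complex.Re e / 8 * 4.
  by rewrite ler_wpM2l ?(ltW e8)//; apply: (le_trans h3); move: z2 h4; clear; lra.
by lra.
Qed.

(** Otherwise there are unit vectors [v N], supported from [N] on, with images of norm above [e].
    The images cluster at some [y]; since [v N] tends weakly to 0, [y] must be 0, a
    contradiction. *)
Lemma compact_tail_small T : T \in compact_op -> tail_small T.
Proof.
move=> /asboolP; rewrite precompactE => cT e e0; apply: contrapT => /forallNP nT.
have vP N : exists v, [/\ tail N v, l2norm v = 1 & e < l2norm (val T v)].
  have := nT N; move=> /existsNP[v /not_implyP[tv /negP]]; rewrite -ltNge => lt.
  have v0 : 0 < l2norm v.
    rewrite lt_neqAle l2norm_ge0 andbT; apply/eqP => v0; move: lt.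
    by rewrite -v0 (l2norm_eq0 (esym v0)) bop0 l2norm0 mulr0 ltxx.
  have nv : normc ((l2norm v)^-1)%:C = (l2norm v)^-1.
    by rewrite normc_real ger0_norm// invr_ge0 ltW.
  exists (((l2norm v)^-1)%:C *: v); split; first exact: tailZ.
    by rewrite l2normZ nv mulVf// gt_eqF.
  by rewrite bopZ l2normZ nv mulrC ltr_pdivlMr.
pose v N := projT1 (cid (vP N)).
have vt N : tail N (v N) by rewrite /v; case: cid => ? [].
have v1 N : l2norm (v N) = 1 by rewrite /v; case: cid => ? [].
have vT N : e < l2norm (val T (v N)) by rewrite /v; case: cid => ? [].
have [] := cT ((fun N => val T (v N)) @ \oo) _.
  by exists 0%N => // N _ /=; apply: subset_closure; exists (v N) => //; rewrite /unit_ball/= v1.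
move=> y [_ cy].
have near_y N0 (d : R) : 0 < d -> exists2 N, (N0 <= N)%N & l2norm (y - val T (v N)) < d.
  move=> d0; have [] := cy ((fun N => val T (v N)) @` [set N | (N0 <= N)%N])
     [set w | l2norm (y - w) < d].
  - by exists N0 => // N /= N0N; exists N.
  - exact: near_l2norm.
  - by move=> _ [[N /= N0N <-] /= lt]; exists N.
(* The square of |y| is <y - T v, y> + <T v, y>, and for a suitable [v N] each term is at most a
   quarter of it. *)
have y0 : y = 0.
  apply/eqP/negP => /negP/l2norm_gt0 y0.
  have y40 : 0 < l2norm y / 4 by rewrite divr_gt0.
  have yy40 : 0 < l2norm y ^+ 2 / 4 by rewrite divr_gt0// exprn_gt0.
  have [N0 hN0] := dotl2_tail_small (val (adjoint T) y) yy40.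
  have [N N0N lt] := near_y N0 _ y40.
  have := hN0 _ (tail_le N0N (vt N)); rewrite -adjointP v1 mulr1 => h1.
  have h2 := dotl2_CS (y - val T (v N)) y.
  have h3 : l2norm (y - val T (v N)) * l2norm y <= l2norm y / 4 * l2norm y.
    by rewrite ler_wpM2r ?l2norm_ge0// ltW.
  have := le_normcD (dotl2 (y - val T (v N)) y) (dotl2 (val T (v N)) y).
  rewrite -dotl2Dl subrK dotl2xx normc_real ger0_norm ?sqr_ge0// => h4.
  have h5 : 0 < l2norm y ^+ 2 by rewrite exprn_gt0.
  have h6 : l2norm y / 4 * l2norm y = l2norm y ^+ 2 / 4 by field.
  by lra.
have [N _] := near_y 0%N e e0.
by rewrite y0 sub0r l2normN => lt; have := lt_trans lt (vT N); rewrite ltxx.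
Qed.

Lemma compact_opE T : T \in compact_op <-> tail_small T.
Proof. by split; [exact: compact_tail_small|exact: tail_small_compact]. Qed.

Lemma adjointK T : adjoint (adjoint T) = T.
Proof.
apply: (@adjoint_unique _ (adjoint T)); first exact: adjointP.
by move=> x y; rewrite dotl2C -adjointP -dotl2C.
Qed.

Lemma adjointM T S : adjoint (T * S) = adjoint S * adjoint T.
Proof.
apply: (@adjoint_unique _ (T * S)); first exact: adjointP.
by move=> x y; rewrite !bop_mulE !adjointP.
Qed.

Lemma adjointB T S : adjoint (T - S) = adjoint T - adjoint S.
Proof.
apply: (@adjoint_unique _ (T - S)); first exact: adjointP.
by move=> x y; rewrite !bop_subE dotl2Dl dotl2Nl dotl2Dr dotl2Nr !adjointP.
Qed.

(** The square of |T^* v| is <T T^* v, v>, and T T^* is compact. *)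
Lemma adjoint_compact T : T \in compact_op -> adjoint T \in compact_op.
Proof.
move=> cT; apply/compact_opE => e e0.
have e20 : 0 < e ^+ 2 by rewrite exprn_gt0.
have [N hN] := compact_tail_small (compact_opMr (adjoint T) cT) e20.
exists N => v /hN; rewrite bop_mulE => le.
rewrite -ler_sqr ?nnegrE ?mulr_ge0 ?l2norm_ge0 ?(ltW e0)//.
rewrite -[leLHS]ger0_norm ?sqr_ge0// -normc_real -dotl2xx -adjointP.
apply: (le_trans (dotl2_CS _ _)); rewrite exprMn [X in _ <= _ * X]expr2 mulrA.
by rewrite ler_wpM2r ?l2norm_ge0.
Qed.

End Compactness.

(** * The Calkin algebra and its masas *)

Section CalkinAlgebra.
Context {R : realType}.
Local Notation normc := (@ComplexField.Normc.normc R).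
Implicit Types (T S : bop R) (p q r : calkin R).

Lemma calkinP q : exists T, q = to_calkin T.
Proof. by exists (calkin_repr q); rewrite calkin_reprK. Qed.

Lemma to_calkin0 : to_calkin 0 = 0 :> calkin R.
Proof.
by have /eqP := to_calkinD (0 : bop R) 0; rewrite addr0 eq_sym -subr_eq0 addrK => /eqP.
Qed.

Lemma to_calkin_eq0 T : to_calkin T = 0 <-> T \in compact_op.
Proof. by rewrite -to_calkin0 to_calkin_eq subr0. Qed.

Lemma to_calkinN T : to_calkin (- T) = - to_calkin T.
Proof. by apply/eqP; rewrite -addr_eq0 -to_calkinD addNr to_calkin0. Qed.

Lemma to_calkinB T S : to_calkin (T - S) = to_calkin T - to_calkin S.
Proof. by rewrite to_calkinD to_calkinN. Qed.

Lemma to_calkin_mul T S : to_calkin (T * S) = to_calkin T * to_calkin S.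
Proof. exact: to_calkinM. Qed.

Lemma to_calkin_scale a T : to_calkin (a *: T) = a *: to_calkin T.
Proof. exact: to_calkinZ. Qed.

Lemma to_calkin1 : to_calkin 1 = 1 :> calkin R.
Proof. by []. Qed.

Lemma calkin_mulZl a p q : (a *: p) * q = a *: (p * q).
Proof.
have [S ->] := calkinP p; have [T ->] := calkinP q.
rewrite -(to_calkin_scale a S) -(to_calkin_mul S T) -(to_calkin_mul (a *: S)).
rewrite -(to_calkin_scale a (S * T)); congr to_calkin.
by apply: bopP => x; rewrite bop_mulE !bop_scaleE.
Qed.

Lemma calkin_mulZr a p q : p * (a *: q) = a *: (p * q).
Proof.
have [S ->] := calkinP p; have [T ->] := calkinP q.
rewrite -(to_calkin_scale a T) -(to_calkin_mul S T) -(to_calkin_mul S (a *: T)).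
rewrite -(to_calkin_scale a (S * T)); congr to_calkin.
by apply: bopP => x; rewrite bop_mulE !bop_scaleE bopZ.
Qed.

Lemma calkin_starE T : calkin_star (to_calkin T) = to_calkin (adjoint T).
Proof.
by apply/to_calkin_eq; rewrite -adjointB; apply: adjoint_compact; exact: to_calkin_repr.
Qed.

Lemma calkin_starK q : calkin_star (calkin_star q) = q.
Proof. by have [T ->] := calkinP q; rewrite !calkin_starE adjointK. Qed.

Lemma calkin_starM p q : calkin_star (p * q) = calkin_star q * calkin_star p.
Proof.
have [S ->] := calkinP p; have [T ->] := calkinP q.
by rewrite -to_calkin_mul !calkin_starE adjointM to_calkin_mul.
Qed.

Lemma opnorm_ge0 T : 0 <= opnorm T.
Proof.
have [M M0 TM] := bop_bounded T; apply: ub_le_sup.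
  exists M => _ [x x1 <-]; apply: le_trans (TM x) _.
  by rewrite -[leRHS]mulr1 ler_wpM2l// ltW.
by exists 0; rewrite ?bop0 /= l2norm0.
Qed.

Lemma l2norm_le_opnorm T x : l2norm (val T x) <= opnorm T * l2norm x.
Proof.
have [M M0 TM] := bop_bounded T.
have [->|/l2norm_gt0 x0] := eqVneq x 0; first by rewrite bop0 l2norm0 mulr0.
have nx : normc ((l2norm x)^-1)%:C = (l2norm x)^-1.
  by rewrite normc_real ger0_norm// invr_ge0 ltW.
rewrite -ler_pdivrMr// mulrC -{1}nx -l2normZ -bopZ; apply: ub_le_sup.
  exists M => _ [y y1 <-]; apply: le_trans (TM y) _.
  by rewrite -[leRHS]mulr1 ler_wpM2l// ltW.
by exists (((l2norm x)^-1)%:C *: x); rewrite //= l2normZ nx mulVf// gt_eqF.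
Qed.

Lemma calkin_norm_lt q (e : R) : calkin_norm q < e ->
  exists T, to_calkin T = q /\ opnorm T < e.
Proof.
move=> /inf_lt [|_ [T /= Tq <-] Te]; last by exists T.
by have [T qT] := calkinP q; exists (opnorm T); exists T.
Qed.

(** Commutants are norm closed: with [T] a small lift of a - b, the commutator of lifts of [a] and
    [s] is that of [T] and [S] up to a compact operator. *)
Lemma commute_closed s a :
  (forall e : R, 0 < e -> exists2 b, b * s = s * b & calkin_norm (a - b) < e) ->
  a * s = s * a.
Proof.
move=> H; apply/eqP; rewrite -subr_eq0; apply/eqP.
have [S sS] := calkinP s; have [U aU] := calkinP a.
rewrite sS aU -!to_calkin_mul -to_calkinB; apply/to_calkin_eq0/compact_opE => e e0.
have [M M0 SM] := bop_bounded S.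
(* The commutator of [T] and [S] then has norm at most 2M e/(4M) = e/2; the other half is for the
   compact error. *)
have d0 : 0 < e / (4 * M) by rewrite divr_gt0// mulr_gt0.
have [b bs /calkin_norm_lt[T [Tab Td]]] := H _ d0.
have e20 : 0 < e / 2 by rewrite divr_gt0.
have cW : U * S - S * U - (T * S - S * T) \in compact_op.
  apply/to_calkin_eq0; rewrite !to_calkinB !to_calkin_mul -sS -aU Tab.
  rewrite mulrBl mulrBr bs; apply/eqP; rewrite subr_eq0; apply/eqP.
  by rewrite opprB addrA subrK.
have [N hN] := compact_tail_small cW e20.
exists N => v /hN; rewrite bop_subE => h.
rewrite -(subrK (val (T * S - S * T) v) (val _ v)); apply: (le_trans (l2normD _ _)).
rewrite (splitr e) mulrDl; apply: lerD => //.
rewrite bop_subE !bop_mulE; apply: (le_trans (l2normB _ _)).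
have h1 : l2norm (val T (val S v)) <= e / (4 * M) * (M * l2norm v).
  apply: (le_trans (l2norm_le_opnorm _ _)).
  by apply: ler_pM; rewrite ?opnorm_ge0 ?l2norm_ge0 ?(ltW Td).
have h2 : l2norm (val S (val T v)) <= M * (e / (4 * M) * l2norm v).
  apply: (le_trans (SM _)); rewrite ler_wpM2l ?(ltW M0)//.
  apply: (le_trans (l2norm_le_opnorm _ _)).
  by rewrite ler_wpM2r ?l2norm_ge0 ?(ltW Td).
apply: (le_trans (lerD h1 h2)); rewrite le_eqVlt; apply/orP; left; apply/eqP.
by field; rewrite gt_eqF.
Qed.

(* The bicommutant of A and q is a commutative C*-algebra, so it is A. *)
Lemma masa_mem (A : set (calkin R)) q : masa A -> calkin_star q = q ->
  (forall a, A a -> a * q = q * a) -> A q.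
Proof.
move=> [[cA commA] maxA] qq Aq.
pose S := [set p | A p \/ p = q].
pose com (X : set (calkin R)) := [set p | forall s, X s -> p * s = s * p].
have comC X : (forall p, X p -> X (calkin_star p)) -> cstar_subalgebra (com X).
  move=> Xstar; split.
  - by move=> s _; rewrite mul0r mulr0.
  - by move=> a b ca cb s Xs; rewrite mulrDl mulrDr ca// cb.
  - by move=> z a ca s Xs; rewrite calkin_mulZl calkin_mulZr ca.
  - by move=> a b ca cb s Xs; rewrite -mulrA cb// mulrA ca// mulrA.
  - move=> a ca s Xs; rewrite -[s]calkin_starK -!calkin_starM ca//.
    exact: Xstar.
  - move=> a Ha s Xs; apply: commute_closed => e /Ha[b cb lt].
    by exists b => //; exact: cb.
have Sstar p : S p -> S (calkin_star p).
  by move=> [Ap|->]; [left; exact: (cstar_subalgebra_star cA)|right].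
(* As [S] lies in its commutant, [com (com S)] lies in [com S], which makes the bicommutant
   commutative. *)
have SS : S `<=` com S.
  by move=> p [Ap|->] s [As|->] //; [exact: commA|exact: Aq|exact/esym/Aq].
have cS := comC _ Sstar; have ccS := comC _ (cstar_subalgebra_star cS).
have <- : com (com S) = A.
  apply: maxA; last by move=> a Aa s /(_ a)->//; left.
  split=> // a b ca cb; apply: ca => s Ss; apply: cb; exact: SS.
by move=> s /(_ q)->//; right.
Qed.

(** The equation says algebraically that r^* r is at most e^2, so that the norm of [r] is at most
    [e]. Such an equation is carried over by any unital *-homomorphism, which spares a proof that
    [F] is isometric. *)
Lemma calkin_eq0_sum_sqr r :
  (forall e : R, 0 < e -> exists s,
    calkin_star r * r + calkin_star s * s = (e ^+ 2)%:C *: (1 : calkin R)) -> r = 0.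
Proof.
have [T ->] := calkinP r => H; apply/to_calkin_eq0/compact_opE => e e0.
have e20 : 0 < e / 2 by rewrite divr_gt0.
have [s] := H _ e20; have [S ->] := calkinP s.
rewrite !calkin_starE -!to_calkin_mul -to_calkinD -to_calkin1 -to_calkin_scale.
move=> /to_calkin_eq/compact_tail_small -/(_ ((e / 2) ^+ 2)) [|N hN].
  by rewrite exprn_gt0.
exists N => v /hN; rewrite bop_subE bop_addE bop_scaleE !bop_mulE.
set w := _ - _ => h.
rewrite -ler_sqr ?nnegrE ?mulr_ge0 ?l2norm_ge0 ?(ltW e0)//.
have := le_trans (dotl2_CS w v) (ler_wpM2r (l2norm_ge0 v) h).
(* Up to an error of (e/2)^2 |v|^2 this number is 0, whence |T v|^2 is at most 2 (e/2)^2 |v|^2. *)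
have -> : dotl2 w v =
    (l2norm (val T v) ^+ 2 + l2norm (val S v) ^+ 2 - (e / 2) ^+ 2 * l2norm v ^+ 2)%:C.
  rewrite /w dotl2Dl dotl2Nl dotl2Dl dotl2Zl !dotl2xx.
  rewrite ![dotl2 (val (adjoint _) _) _]dotl2C -!adjointP !dotl2xx.
  have conjR (t : R) : (t%:C)^* = t%:C :> R[i] by exact: conjc_real.
  by rewrite !conjR !(rmorphB, rmorphD, rmorphM).
rewrite normc_real => /(le_trans (ler_norm _)) h1.
have h2 := sqr_ge0 (l2norm (val S v)).
have h3 : 0 <= e ^+ 2 * l2norm v ^+ 2 by rewrite mulr_ge0// sqr_ge0.
have h4 : (e / 2) ^+ 2 * l2norm v * l2norm v = e ^+ 2 * l2norm v ^+ 2 / 4 by field.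
have h5 : (e / 2) ^+ 2 * l2norm v ^+ 2 = e ^+ 2 * l2norm v ^+ 2 / 4 by field.
by rewrite h4 h5 in h1; rewrite exprMn; lra.
Qed.

End CalkinAlgebra.

(** * Construction of operators from their columns and coordinates *)

Section Operators.
Context {R : realType}.
Local Notation normc := (@ComplexField.Normc.normc R).
Implicit Types (v w x y : ell2 R) (T S : bop R).

Lemma exp_half_lt (e : R) : 0 < e -> exists n, 2 ^- n < e.
Proof.
move=> e0; have [N _ /(_ N (leqnn N))] := near_infty_natSinv_expn_lt (PosNum e0).
by rewrite div1r; exists N.
Qed.

(** If [x] is supported from n >= N on, then |T x| is at most the sum of 2^-i |x_i| over i >= n,
    hence at most 2 2^-n |x|. *)
Lemma summable_columns_compact T N :
  (forall i, (N <= i)%N -> l2norm (val T (delta i)) <= 2 ^- i) -> T \in compact_op.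
Proof.
move=> TN; apply/compact_opE => e e0.
have e20 : 0 < e / 2 by rewrite divr_gt0.
have [n0 n0e] := exp_half_lt e20.
exists (maxn N n0) => x.
have : 2 ^- (maxn N n0) <= e / 2.
  apply/ltW; apply: le_lt_trans n0e; rewrite lef_pV2 ?posrE ?exprn_gt0//.
  by rewrite ler_eXn2l ?leq_maxr// ltr1n.
have := leq_maxl N n0; move: (maxn N n0) => n Nn ne tx.
(* The constant is the sum of 2^-i over n <= i < n + j. *)
have partial j : l2norm (val T (trunc (n + j) (val x))) <=
    (2 * 2 ^- n - 2 * 2 ^- (n + j)) * l2norm x.
  elim: j => [|j IH].
    rewrite addn0 subrr mul0r; have -> : trunc n (val x) = 0.
      by apply: ell2P => k; rewrite val_truncE; case: ltnP => // /tx.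
    by rewrite bop0 l2norm0.
  rewrite addnS truncE big_nat_recr//= -truncE bopD bopZ.
  apply: (le_trans (l2normD _ _)).
  have h : l2norm (val x (n + j)%N *: val T (delta (n + j))) <= 2 ^- (n + j) * l2norm x.
    rewrite l2normZ mulrC; apply: ler_pM; rewrite ?l2norm_ge0 ?normc_ge0 ?l2norm_coord//.
    by apply: TN; rewrite (leq_trans Nn)// leq_addr.
  apply: (le_trans (lerD IH h)); rewrite -mulrDl ler_wpM2r ?l2norm_ge0//.
  rewrite exprS invfM; have := invr_ge0 (2 ^+ (n + j) : R).
  by lra.
have [M M0 TM] := bop_bounded T.
have le_e : l2norm (val T x) <= 2 * 2 ^- n * l2norm x.
  apply/ler_addgt0Pr => d d0; have dM0 : 0 < d / M by rewrite divr_gt0.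
  have /cvgrPdist_lt/(_ _ dM0)[m _ /(_ (n + m)%N (leq_addl _ _))] := @cvg_trunc _ x.
  rewrite sub0r normrN ger0_norm ?l2norm_ge0// => /ltW dm.
  rewrite -(subrK (trunc (n + m) (val x)) x) bopD addrC.
  apply: (le_trans (l2normD _ _)); rewrite subrK; apply: lerD.
    apply: (le_trans (partial m)); rewrite ler_wpM2r ?l2norm_ge0// lerBlDr lerDl.
    by rewrite mulr_ge0// invr_ge0 exprn_ge0.
  by apply: (le_trans (TM _)); rewrite mulrC -ler_pdivlMr.
apply: (le_trans le_e); rewrite ler_wpM2r ?l2norm_ge0//.
by lra.
Qed.

(** This form covers both the diagonal projection and the block isometry below. *)
Lemma weighted_composition (c : nat -> R[i]) (idx : nat -> nat) :
  (forall x n, series (fun k => normc (c k * val x (idx k)) ^+ 2) n <= l2norm x ^+ 2) ->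
  exists V : bop R, forall x k, val (val V x) k = c k * val x (idx k).
Proof.
move=> cidx.
have ss x : (fun k => c k * val x (idx k)) \in square_summable.
  apply/asboolP; exact: (bounded_series_cvg (sqabs_ge0 _) (cidx x)).1.
pose f x : ell2 R := exist (fun u => u \in square_summable) _ (ss x).
have fE x k : val (f x) k = c k * val x (idx k) by [].
have fb : f \in bounded_op.
  apply/asboolP; split.
    move=> a x y; apply: ell2P => k.
    by rewrite val_addE val_scaleE !fE val_addE val_scaleE; ring.
  exists 1 => x; rewrite mul1r -ler_sqr ?nnegrE ?l2norm_ge0// l2norm_sqr.
  exact: (bounded_series_cvg (sqabs_ge0 _) (cidx x)).2.
by exists (exist (fun g => g \in bounded_op) f fb).
Qed.

(** [D] is the projection onto the even coordinates. If D - z were compact, a far even and a far odd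
    basis vector would make both 1 - z and z small. *)
Lemma exists_nonscalar_diagonal :
  exists D : bop R, adjoint D = D /\ forall z, D - z *: (1 : bop R) \notin compact_op.
Proof.
have [x n|D DE] := @weighted_composition (fun k => (~~ odd k)%:R) id.
  apply: (@le_trans _ _ (series (sqabs (val x)) n)); last first.
    by rewrite l2norm_sqr; exact: series_le_limn n (sqabs_ge0 _) (@ell2_cvg _ x).
  apply: ler_sum => k _; rewrite /sqabs; case: odd; last by rewrite mul1r.
  by rewrite mul0r ComplexField.Normc.normc0 expr0n sqr_ge0.
exists D; split=> [|z].
  apply: (@adjoint_unique _ D); first exact: adjointP.
  move=> x y; congr (limn (series _)); apply/funext => k; rewrite /dotseq !DE.
  by case: odd; rewrite /= ?mul0r ?mul1r ?rmorph0 ?mulr0.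
apply/negP => /compact_tail_small/(_ (1 / 4)) [|N hN]; first by rewrite divr_gt0.
have Dd k : val D (delta k) = (~~ odd k)%:R *: delta k.
  apply: ell2P => i; rewrite DE val_scaleE val_delta.
  by case: (eqVneq i k) => [->//|_]; rewrite !mulr0.
have h k : (N <= k)%N -> normc ((~~ odd k)%:R - z) <= 1 / 4.
  move=> Nk; have := hN _ (tail_le Nk (@tail_delta _ k)).
  by rewrite bop_subE bop_scaleE bop_oneE Dd -scalerBl l2normZ l2norm_delta !mulr1.
have N2 : (N <= N.*2)%N by rewrite -addnn leq_addr.
have h1 := h N.*2 N2; have h2 := h N.*2.+1 (leqW N2).
move: h1 h2; rewrite /= odd_double/= sub0r => h1 h2.
have hz : normc (- z) = normc z by apply: complexI; rewrite -!normCE normrN.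
have := le_normcD (1 - z) z; rewrite subrK ComplexField.Normc.normc1 -hz.
by lra.
Qed.

Lemma real_series_sqabs (u : nat -> R[i]) n :
  (series (fun k => normc (u k) ^+ 2) n)%:C = \sum_(0 <= k < n) u k * (u k)^*.
Proof.
rewrite /series/= rmorph_sum; apply: eq_bigr => k _.
by rewrite -sqr_normc normCE -rmorphXn.
Qed.

(** * The isometry with a given normalised block sequence as columns *)

Section Blocks.
Variables (a : nat -> nat) (w : nat -> ell2 R).
Hypotheses (a0 : a 0%N = 0%N) (a_incr : forall i, (a i < a i.+1)%N).
Hypotheses (w1 : forall i, l2norm (w i) = 1).
Hypothesis w_supp : forall i k, ~~ (a i <= k < a i.+1)%N -> val (w i) k = 0.

Let a_ge i : (i <= a i)%N.
Proof. by elim: i => // i IH; exact: leq_ltn_trans IH (a_incr i). Qed.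

Let a_le i j : (i <= j)%N -> (a i <= a j)%N.
Proof.
elim: j => [|j IH]; first by rewrite leqn0 => /eqP->.
by rewrite leq_eqVlt => /predU1P[->//|/IH/leq_trans->//]; exact: ltnW.
Qed.

(** The intervals between successive values of [a] partition the natural numbers; [idx k] is the
    number of the interval containing [k]. *)
Let idx_ex k : exists i, (a i <= k < a i.+1)%N.
Proof.
have ex0 : exists i, (a i <= k)%N by exists 0%N; rewrite a0.
have [i ik im] := ex_maxnP ex0 (fun i => leq_trans (a_ge i)).
by exists i; rewrite ik/= ltnNge; apply/negP => /im; rewrite ltnn.
Qed.

Let idx k := projT1 (cid (idx_ex k)).

Let idxP i k : (a i <= k < a i.+1)%N -> idx k = i.
Proof.
rewrite /idx; case: cid => j /= /andP[jk kj] /andP[ik ki].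
have [ij|ji|//] := ltngtP j i.
  by have := leq_trans kj (a_le ij); rewrite ltnNge ik.
by have := leq_trans ki (a_le ji); rewrite ltnNge jk.
Qed.

Let c k := val (w (idx k)) k.

(** On block [i] the factors u i and v i are constant, and the squared moduli of the coordinates of
    [w i] add up to 1. *)
Let block_dot (u v : nat -> R[i]) m :
  \sum_(0 <= k < a m) (c k * u (idx k)) * (c k * v (idx k))^* =
  \sum_(0 <= i < m) u i * (v i)^*.
Proof.
elim: m => [|m IH]; first by rewrite a0 !big_geq.
rewrite (big_cat_nat (leq0n (a m)) (ltnW (a_incr m)))/= IH big_nat_recr//=; congr (_ + _).
have one : \sum_(a m <= k < a m.+1) val (w m) k * (val (w m) k)^* = 1.
  have wt : w m = trunc (a m.+1) (val (w m)).
    apply: ell2P => k; rewrite val_truncE; case: ltnP => // ak.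
    by rewrite w_supp// negb_and -leqNgt ak orbT.
  have := l2norm_trunc_sqr (a m.+1) (val (w m)); rewrite -wt w1 expr1n /series/=.
  rewrite (big_cat_nat (leq0n (a m)) (ltnW (a_incr m)))/= big_nat big1 ?add0r.
    move=> /(congr1 (fun t : R => t%:C)); rewrite rmorph_sum rmorph1 => ->.
    by apply: eq_bigr => k _; rewrite /sqabs rmorphXn -sqr_normc normCE.
  move=> k /andP[_ kam]; rewrite /sqabs w_supp ?ComplexField.Normc.normc0 ?expr0n//.
  by rewrite negb_and -ltnNge kam.
rewrite -[RHS]mulr1 -one mulr_sumr [LHS]big_nat [RHS]big_nat; apply: eq_bigr => k akm.
by rewrite /c (idxP akm) rmorphM; ring.
Qed.

(** [V x] is the sum of the x_i w_i; as the blocks are disjoint, only [w (idx k)] contributes to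
    coordinate [k]. *)
Lemma block_isometry : exists V : bop R,
  adjoint V * V = 1 /\ forall i, val V (delta i) = w i.
Proof.
have [x n|V VE] := @weighted_composition c idx.
  apply: (@le_trans _ _ (series (fun k => normc (c k * val x (idx k)) ^+ 2) (a n))).
    rewrite /series/= (big_cat_nat (leq0n n) (a_ge n))/= lerDl.
    by apply: sumr_ge0 => k _; exact: sqr_ge0.
  apply: (@le_trans _ _ (series (sqabs (val x)) n)); last first.
    by rewrite l2norm_sqr; exact: series_le_limn n (sqabs_ge0 _) (@ell2_cvg _ x).
  rewrite -lecR [leLHS](@real_series_sqabs (fun k => c k * val x (idx k))).
  by rewrite [leRHS](@real_series_sqabs (val x) n) block_dot.
exists V; split; last first.
  move=> i; apply: ell2P => k; rewrite VE val_delta /c.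
  have := projT2 (cid (idx_ex k)); rewrite -/(idx k) => /= ik.
  have [->|ne] := eqVneq (idx k) i; first by rewrite mulr1.
  by rewrite mulr0 w_supp//; apply: contra_neqN ne => /idxP.
apply: bopP => x; rewrite bop_mulE bop_oneE; apply: dotl2_inj => y.
rewrite -adjointP.
have ai : a @ \oo --> \oo.
  by move=> A [N _ NA]; exists N => // n /= Nn; apply: NA; exact: leq_trans Nn (a_ge n).
(* Only partial sums ending at a block boundary are given by [block_dot], so the limit is taken
   along [a]. *)
have h := cvg_comp _ _ ai (@cvg_dotseq _ (val V y) (val V x)).
rewrite (_ : _ \o a = series (dotseq y x)) in h; last first.
  apply/funext => m; apply: etrans (block_dot (val y) (val x) m).
  by apply: eq_bigr => k _; rewrite /dotseq !VE.
exact: (@cvg_unique _ (@norm_hausdorff _ _) _ _ _ _ h (@cvg_dotseq _ y x)).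
Qed.
End Blocks.

End Operators.

(** * Diagonal sequences from fewer than p sets *)

Lemma finite_set_ubound (I : Type) (X : set I) (f : I -> nat) : finite_set X ->
  exists r, forall m, X m -> (f m <= r)%N.
Proof.
move=> /(finite_image f)/finite_seqP[s sE]; exists (\max_(i <- s) i) => m Xm.
have : [set` s] (f m) by rewrite -sE; exists m.
by move=> fs; exact: (@leq_bigmax_seq _ s xpredT id).
Qed.

(** The sequence is chosen in a pseudointersection of the sets [A U]. Being infinite does not make
    [rank] unbounded on it, so that must be forced by the family itself. *)
Lemma pseudointersection_sequence (T : pointedType) (B : set T) (A : T -> set nat)
    (rank : nat -> nat) :
  ~ (pseudointersection_number #<= B) ->
  (forall G, G `<=` B -> finite_set G -> forall k,
    exists2 m, (k <= rank m)%N & forall U, G U -> A U m) ->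
  exists s : nat -> nat, (forall j, (j <= rank (s j))%N) /\
    forall U, B U -> exists N, forall j, (N <= j)%N -> A U (s j).
Proof.
(* For finite [B] the hypothesis with G := B gives the sequence directly; the argument for infinite
   [B] needs infinitely many distinct members to carry the rank conditions. *)
move=> pB cA; have [finB|infB] := pselect (finite_set B).
  have sP j : exists m, (j <= rank m)%N /\ forall U, B U -> A U m.
    by have [m] := cA B (@subset_refl _ _) finB j; exists m.
  exists (fun j => projT1 (cid (sP j))); split=> [j|U BU]; first by case: cid => m [].
  by exists 0%N => j _; case: cid => m /= [_]; exact.
have /infiniteP/pcard_leP[f] := infB.
have fB n : B (f n) by exact: (@funS _ _ _ _ f).
have fI m n : f m = f n -> m = n by apply: (@inj _ _ _ f); rewrite inE.
(* The f k are distinct, so shrinking A (f k) makes every pseudointersection leave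
   {rank < k} for all k without enlarging the family. *)
pose A' U := A U `&` [set m | forall k, f k = U -> (k <= rank m)%N].
have cF : centered_family (A' @` B).
  move=> G GF finG _ /(finite_set_ubound rank)[r hr].
  have gP S : exists U, G S -> B U /\ A' U = S.
    have [GS|nGS] := pselect (G S); last by exists (f 0%N).
    by have [U BU US] := GF _ GS; exists U.
  pose g S := projT1 (cid (gP S)).
  have gS S : G S -> B (g S) /\ A' (g S) = S by rewrite /g; case: cid.
  pose H := g @` G.
  have finH : finite_set H by exact: finite_image.
  have HB : H `<=` B by move=> _ [S GS <-]; exact: (gS _ GS).1.
  (* [r'] bounds the [k] with [f k] in [H], so rank at least [r'] meets every added condition, and
     rank above [r] contradicts the assumed bound on the intersection. *)
  have [|r' hr'] := @finite_set_ubound _ (f @^-1` H) id.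
    by apply: finite_preimage => // m n _ _; exact: fI.
  have [m] := cA H HB finH (maxn r.+1 r'); rewrite geq_max => /andP[rm r'm] Hm.
  suff : (rank m <= r)%N by rewrite leqNgt rm.
  apply: hr => S GS; rewrite -(gS _ GS).2; split; first by apply: Hm; exists S.
  by move=> k fk; apply: leq_trans r'm; apply: hr'; rewrite /preimage/= fk; exists S.
have [X [Xinf XA]] : exists X, pseudointersection (A' @` B) X.
  apply: contrapT => nX; apply: pB; apply: card_le_trans (card_image_le A' B).
  apply: (pseudointersection_numberP.2 (A' @` B)); split=> // S FS.
  have := cF [set S]; rewrite bigcap_set1; apply=> //; last by exists S.
  by move=> _ ->.
(* Otherwise [X] would be disjoint from [A' (f j)], hence finite. *)
have sP j : exists m, X m /\ (j <= rank m)%N.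
  apply: contrapT => /forallNP nm; apply: Xinf.
  apply: sub_finite_set (XA (A' (f j)) _); last by exists (f j).
  move=> m Xm; split=> // -[_ /(_ j erefl) jm]; exact: (nm m).
exists (fun j => projT1 (cid (sP j))); split=> [j|U BU]; first by case: cid => m [].
(* The finitely many exceptions have rank at most [r], and from [r.+1] on the sequence has larger
   rank. *)
have [|r hr] := @finite_set_ubound _ (X `\` A' U) rank; first by apply: XA; exists U.
exists r.+1 => j rj; case: cid => m /= [Xm jm].
apply: contrapT => nA; have : (rank m <= r)%N by apply: hr; split=> // -[].
by rewrite leqNgt (leq_trans rj jm).
Qed.

(** * Coding finitely supported rational vectors by natural numbers *)

Section Codes.
Context {R : realType}.
Local Notation normc := (@ComplexField.Normc.normc R).
Implicit Types v : ell2 R.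

Definition rat_complex (q : rat * rat) : R[i] := (ratr q.1)%:C + 'i%C * (ratr q.2)%:C.

Lemma rat_complex_dense (z : R[i]) (d : R) : 0 < d ->
  exists q, normc (z - rat_complex q) < d.
Proof.
move=> d0; have near_rat (t : R) : exists q : rat, `|t - ratr q| < d / 2.
  have [|q] := @rat_in_itvoo _ (t - d / 2) (t + d / 2); first by lra.
  by rewrite in_itv/= => /andP[h1 h2]; exists q; rewrite ltr_norml; apply/andP; split; lra.
have [q1 h1] := near_rat (complex.Re z); have [q2 h2] := near_rat (complex.Im z).
exists (q1, q2).
have -> : z - rat_complex (q1, q2) =
    (complex.Re z - ratr q1)%:C + 'i%C * (complex.Im z - ratr q2)%:C.
  by rewrite {1}(complexE z) /rat_complex !rmorphB /=; ring.
apply: (le_lt_trans (le_normcD _ _)).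
rewrite ComplexField.Normc.normcM !normc_real.
have -> : normc 'i%C = 1 by rewrite /ComplexField.Normc.normc/= expr0n expr1n add0r sqrtr1.
by lra.
Qed.

(** A position and the entries from there on. This type is countable, so sets of such vectors become
    sets of natural numbers, to which p applies. *)
Definition code : Type := (nat * seq (rat * rat))%type.

(** A number that codes nothing stands for the zero vector. *)
Definition code_of (m : nat) : code := odflt (0%N, [::]) (unpickle m).

Definition code_rank (m : nat) : nat := (code_of m).1.

Definition code_stop (m : nat) : nat := (code_rank m + size (code_of m).2)%N.

Definition code_vec (m : nat) : ell2 R := trunc (code_stop m)
  (fun k => if (k < code_rank m)%N then 0
            else rat_complex (nth (0, 0) (code_of m).2 (k - code_rank m))).

Lemma code_vec_supp m k : ~~ (code_rank m <= k < code_stop m)%N -> val (code_vec m) k = 0.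
Proof.
by rewrite /code_vec val_truncE negb_and -ltnNge; case: (k < _)%N => //=; case: (k < _)%N.
Qed.

Lemma code_vec_dense n v (e : R) : tail n v -> 0 < e ->
  exists2 m, code_rank m = n & l2norm (v - code_vec m) < e.
Proof.
move=> tv e0; have e20 : 0 < e / 2 by rewrite divr_gt0.
have /cvgrPdist_lt/(_ _ e20)[L _ /(_ (n + L)%N (leq_addl _ _))] := @cvg_trunc _ v.
rewrite sub0r normrN ger0_norm ?l2norm_ge0// => vL.
(* Half of [e] pays for the truncation at n + L, the other half for n + L coordinates with error [d]
   each; the successor keeps the denominator nonzero. *)
pose d := e / 2 / (n + L).+1%:R.
have d0 : 0 < d by rewrite divr_gt0.
pose q k := projT1 (cid (rat_complex_dense (val v k) d0)).
have qd k : normc (val v k - rat_complex (q k)) < d by rewrite /q; case: cid.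
pose m := pickle ((n, mkseq (fun j => q (n + j)%N) L) : code).
have mE : code_of m = (n, mkseq (fun j => q (n + j)%N) L) by rewrite /code_of pickleK.
exists m; first by rewrite /code_rank mE.
have sE : code_stop m = (n + L)%N by rewrite /code_stop /code_rank mE size_mkseq.
rewrite -(subrK (trunc (n + L) (val v)) v) -addrA.
apply: (le_lt_trans (l2normD _ _)); rewrite (splitr e); apply: ltr_leD => //.
have -> : trunc (n + L) (val v) - code_vec m =
    trunc (n + L) (fun k => if (k < n)%N then 0 else val v k - rat_complex (q k)).
  apply: ell2P => k; rewrite val_addE val_oppE /code_vec !val_truncE sE.
  case: ltnP => kL; last by rewrite subr0.
  rewrite /code_rank mE; case: ltnP => kn; first by rewrite (tv _ kn) subr0.
  by rewrite nth_mkseq ?subnKC// ltn_subLR.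
rewrite truncE; apply: (@le_trans _ _ (\sum_(0 <= k < n + L) d)).
  elim: (n + L)%N => [|N IH]; first by rewrite !big_geq// l2norm0.
  rewrite !big_nat_recr//=; apply: (le_trans (l2normD _ _)); apply: lerD => //.
  rewrite l2normZ l2norm_delta mulr1; case: ltnP => _; last exact/ltW/qd.
  by rewrite ComplexField.Normc.normc0 ltW.
rewrite sumr_const_nat subn0 /d -[leLHS]mulr_natr [leLHS]mulrAC ler_pdivrMr// ler_wpM2l ?(ltW e20)//.
by rewrite ler_nat.
Qed.

End Codes.

(** * Approximate kernel vectors and the isometry built from them *)

Section QuasiCentralVectors.
Context {R : realType}.
Local Notation normc := (@ComplexField.Normc.normc R).
Implicit Types (v w : ell2 R) (T H : bop R).

Lemma bop_nat_bounded T : exists M : nat, forall v, l2norm (val T v) <= M%:R * l2norm v.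
Proof.
have [M M0 TM] := bop_bounded T; exists (Num.bound M) => v.
by apply: (le_trans (TM v)); rewrite ler_wpM2r ?l2norm_ge0// ltW// archi_boundP// ltW.
Qed.

(** Coordinate [k] of [T v] is the inner product of [v] with T^* delta_k, which is small when [v]
    lives far out. *)
Lemma trunc_tail_small T n (e : R) : 0 < e -> exists N, forall v, tail N v ->
  l2norm (trunc n (val (val T v))) <= e * l2norm v.
Proof.
elim: n e => [|n IH] e e0.
  exists 0%N => v _; rewrite truncE big_geq// l2norm0.
  by rewrite mulr_ge0 ?l2norm_ge0 ?(ltW e0).
have e20 : 0 < e / 2 by rewrite divr_gt0.
have [N1 h1] := IH _ e20.
have [N2 h2] := dotl2_tail_small (val (adjoint T) (delta n)) e20.
exists (maxn N1 N2) => v tv; rewrite truncE big_nat_recr//= -truncE.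
apply: (le_trans (l2normD _ _)); rewrite (splitr e) mulrDl; apply: lerD.
  by apply: h1; apply: tail_le tv; exact: leq_maxl.
rewrite l2normZ l2norm_delta mulr1 -dotl2_delta adjointP.
by apply: h2; apply: tail_le tv; exact: leq_maxr.
Qed.

(** As [H] is not compact, some [v] arbitrarily far out has |H v| > e |v|, while all [S i] nearly
    annihilate [H v]. The first [n] coordinates of [H v] are negligible too, so a code vector of
    rank [n] approximates it. *)
Lemma code_vec_approx_kernel (I : Type) (G : set I) (S : I -> bop R) H :
  finite_set G -> H \notin compact_op -> (forall i, G i -> S i * H \in compact_op) ->
  forall n, exists m, [/\ code_rank m = n, code_vec m != 0 :> ell2 R &
    forall i, G i -> l2norm (val (S i) (code_vec m)) <= 2 ^- n * l2norm (code_vec m : ell2 R)].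
Proof.
move=> finG /negP nH cSH n.
have [e e0 eH] : exists2 e, 0 < e & forall N, exists2 v, tail N v & e * l2norm v < l2norm (val H v).
  apply: contrapT => /forall2NP ne; apply: nH; apply/compact_opE => e e0.
  have [//|/existsNP[N nN]] := ne e; exists N => v tv.
  by rewrite leNgt; apply/negP => lt; apply: nN; exists v.
pose b : R := 2 ^- n.
have b0 : 0 < b by rewrite invr_gt0 exprn_gt0.
have b1 : b <= 1 by rewrite invf_le1 ?exprn_gt0// exprn_ege1// ler1n.
pose M0 i := projT1 (cid (bop_nat_bounded (S i))).
have M0P i v : l2norm (val (S i) v) <= (M0 i)%:R * l2norm v by rewrite /M0; case: cid.
have [M MP] := finite_set_ubound M0 finG.
have SM i v : G i -> l2norm (val (S i) v) <= M%:R * l2norm v.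
  by move=> Gi; apply: (le_trans (M0P i v)); rewrite ler_wpM2r ?l2norm_ge0// ler_nat MP.
have be0 : 0 < b * e / 4 by rewrite divr_gt0// mulr_gt0.
have NP i : exists N, G i -> forall v, tail N v -> l2norm (val (S i * H) v) <= b * e / 4 * l2norm v.
  have [Gi|nGi] := pselect (G i); last by exists 0%N.
  by have [N hN] := compact_tail_small (cSH i Gi) be0; exists N.
pose N0 i := projT1 (cid (NP i)).
have N0P i v : G i -> tail (N0 i) v -> l2norm (val (S i * H) v) <= b * e / 4 * l2norm v.
  by rewrite /N0; case: cid => N /= hN Gi; exact: hN.
have [N NN] := finite_set_ubound N0 finG.
(* The code vector will differ from [H v] by at most 2d |v|. This must stay below b e |v|/4 after
   applying an [S i] of bound [M], and leave the code vector longer than e |v|/2. *)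
pose d := b * e / (8 * M.+1%:R).
have d0 : 0 < d by rewrite divr_gt0 ?mulr_gt0.
have dM : d * M%:R <= b * e / 8.
  rewrite /d invfM mulrA -mulrA ler_piMr ?divr_ge0 ?mulr_ge0 ?(ltW b0) ?(ltW e0)//.
  by rewrite mulrC ler_pdivrMr// mul1r ler_nat.
have d8 : d <= e / 8.
  rewrite /d invfM mulrA ler_pdivrMr//; apply: (@le_trans _ _ (e / 8)).
    by rewrite ler_pM2r// ler_piMl ?(ltW e0).
  by rewrite ler_peMr ?divr_ge0 ?(ltW e0)// ler1n.
have [N' hN'] := trunc_tail_small H n d0.
have [v tv Hv] := eH (maxn N N').
have v0 : 0 < l2norm v.
  rewrite l2norm_gt0//; apply: contraTneq Hv => ->.
  by rewrite bop0 !l2norm0 mulr0 ltxx.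
have h1 := hN' _ (tail_le (leq_maxr _ _) tv).
have [m mn vm] := code_vec_dense (@tail_subtrunc _ n (val H v)) (mulr_gt0 d0 v0).
have vm2 : l2norm (code_vec m - val H v) <= 2 * d * l2norm v.
  rewrite l2norm_distC -(subrK (trunc n (val (val H v))) (val H v)) addrAC.
  apply: (le_trans (l2normD _ _)); move: h1 vm; lra.
have vme : e / 2 * l2norm v < l2norm (code_vec m : ell2 R).
  have := l2normB (code_vec m) (code_vec m - val H v); rewrite subKr => h2.
  have h3 : d * l2norm v <= e / 8 * l2norm v by rewrite ler_wpM2r ?l2norm_ge0.
  have h4 : 0 < e * l2norm v by rewrite mulr_gt0.
  by lra.
exists m; split=> //.
  apply: contraTneq vme => ->; rewrite l2norm0 -leNgt.
  by rewrite mulr_ge0 ?l2norm_ge0// divr_ge0 ?(ltW e0).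
move=> i Gi; rewrite -(subrK (val H v) (code_vec m)) bopD.
apply: (le_trans (l2normD _ _)).
have h2 := SM i (code_vec m - val H v) Gi.
have h3 := N0P i v Gi (tail_le (leq_trans (NN i Gi) (leq_maxl _ _)) tv).
rewrite bop_mulE in h3.
have h4 : M%:R * l2norm (code_vec m - val H v) <= M%:R * (2 * d * l2norm v).
  by rewrite ler_wpM2l.
have h5 : d * M%:R * l2norm v <= b * e / 8 * l2norm v by rewrite ler_wpM2r ?l2norm_ge0.
rewrite subrK -/b; apply: (@le_trans _ _ (b * (e / 2 * l2norm v))); last first.
  by rewrite ler_wpM2l ?(ltW b0)// ltW.
have -> : b * (e / 2 * l2norm v) = b * e / 4 * l2norm v + 2 * (b * e / 8 * l2norm v) by field.
by move: h2 h3 h4 h5; lra.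
Qed.

(** A subsequence of the code vectors has successive disjoint supports; normalised, it gives the
    columns of [V]. Column [k] of [S i * V] has norm at most 2^-k for large [k], so
    [summable_columns_compact] applies. *)
Lemma block_sequence_isometry (I : Type) (B : set I) (S : I -> bop R) (s : nat -> nat) :
  B !=set0 -> (forall j, (j <= code_rank (s j))%N) ->
  (forall i, B i -> exists N, forall j, (N <= j)%N -> code_vec (s j) != 0 :> ell2 R /\
     l2norm (val (S i) (code_vec (s j))) <=
       2 ^- (code_rank (s j)) * l2norm (code_vec (s j) : ell2 R)) ->
  exists V : bop R, adjoint V * V = 1 /\ forall i, B i -> S i * V \in compact_op.
Proof.
move=> [i0 Bi0] sr sS; have [N0 hN0] := sS _ Bi0.
(* That a code vector is nonzero does not depend on [i], so the threshold of the single index [i0]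
   serves to discard the zero ones. *)
pose t j := s (j + N0)%N.
have tr j : (j <= code_rank (t j))%N by apply: leq_trans (sr _); exact: leq_addr.
have t0 j : code_vec (t j) != 0 :> ell2 R by apply: (hN0 _ _).1; exact: leq_addl.
have tlt j : (code_rank (t j) < code_stop (t j))%N.
  rewrite ltnNge; apply: contra_neqN (t0 j) => le.
  apply: ell2P => k; apply: code_vec_supp; apply/negP => /andP[h1 h2].
  by have := leq_trans h2 (leq_trans le h1); rewrite ltnn.
(* The index max(i, a i) gives vector [i] rank at least [a i], so that it starts after its
   predecessors, and at least [i], so that its error is at most 2^-i. *)
pose a := fix a i := if i is i'.+1 then code_stop (t (maxn i' (a i'))) else 0%N.
pose m i := t (maxn i (a i)).
have am i : (a i <= code_rank (m i))%N by apply: leq_trans (tr _); exact: leq_maxr.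
have im i : (i <= code_rank (m i))%N by apply: leq_trans (tr _); exact: leq_maxl.
have n0 i : 0 < l2norm (code_vec (m i) : ell2 R) by apply: l2norm_gt0; exact: t0.
pose w i : ell2 R := ((l2norm (code_vec (m i) : ell2 R))^-1)%:C *: code_vec (m i).
have nw i : normc ((l2norm (code_vec (m i) : ell2 R))^-1)%:C = (l2norm (code_vec (m i) : ell2 R))^-1.
  by rewrite normc_real ger0_norm// invr_ge0 ltW.
have [||||V [V1 Vw]] := @block_isometry _ a w.
- by [].
- by move=> i; apply: leq_ltn_trans (am i) _; exact: tlt.
- by move=> i; rewrite l2normZ nw mulVf// gt_eqF.
- move=> i k ik; rewrite val_scaleE code_vec_supp ?mulr0//.
  apply: contra ik => /andP[h1 h2]; apply/andP; split=> //.
  exact: leq_trans (am i) h1.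
exists V; split=> // i Bi; have [N hN] := sS _ Bi.
apply: (@summable_columns_compact _ _ N) => k Nk.
rewrite bop_mulE Vw bopZ l2normZ nw mulrC ler_pdivrMr//.
have [|_ le] := hN (maxn k (a k) + N0)%N.
  by apply: (leq_trans Nk); apply: leq_trans (leq_addr _ _); exact: leq_maxl.
apply: (le_trans le); rewrite ler_wpM2r ?l2norm_ge0//.
by rewrite lef_pV2 ?posrE ?exprn_gt0// ler_eXn2l ?ltr1n//; exact: im.
Qed.

End QuasiCentralVectors.

(** * Functions on [K], and the contradiction at a point of small character *)

Section Characters.
Context {R : realType} {K : topologicalType}.
Hypotheses (K_compact : compact [set: K]) (K_hausdorff : hausdorff_space K).
Local Notation normc := (@ComplexField.Normc.normc R).
Local Notation C := (CK R K).
Local Notation fn f := (f : continuousType K R[i]).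

Lemma real_complex_continuous (f : K -> R) : continuous f ->
  continuous (fun y => (f y)%:C : R[i]).
Proof.
move=> cf y; apply/(@cvgrPdist_lt _ _ _ (nbhs y) (nbhs_filter y)) => e.
rewrite ltcE/= => /andP[/eqP e0 epos].
have /cvgrPdist_lt/(_ _ epos) := cf y.
apply: filterS => z /=; rewrite -rmorphB normCE normc_real ltcE/= e0 eqxx//.
Qed.

(** By regularity Urysohn's lemma can be applied to the closure of a smaller neighbourhood instead
    of the point, so that the function is 1 near [x] and finitely many of them are 1 on a common
    neighbourhood. *)
Lemma ck_cutoff (x : K) (U : set K) : nbhs x U -> exists f : C,
  [/\ forall y, normc (fn f y) <= 1, forall y, ~ U y -> fn f y = 0 &
    \forall y \near x, fn f y = 1].
Proof.
move=> xU; have xUo : nbhs x U^° by exact: nbhs_interior.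
have [W xW WU] := @compact_regular _ x setT K_hausdorff K_compact filterT _ xUo.
have [|||f [cf f0 f1 f01]] := @urysohn_ext_itv K R (compact_normal K_hausdorff K_compact)
    (~` U^°) (closure W) 0 1 _ _ _ ltr01.
- exact/open_closedC/open_interior.
- exact: closed_closure.
- by apply/seteqP; split=> // y [nU /WU].
exists (mkcts (real_complex_continuous cf)); split=> [y|y nU|].
- rewrite -[X in normc X]/((f y)%:C) normc_real; have /= := f01 _ (imageP f (I : [set: K] y)).
  by rewrite in_itv/= => /andP[h0 h1]; rewrite ger0_norm.
- rewrite -[LHS]/((f y)%:C); have -> // : f y = 0.
  by apply: f0; exists y => // /interior_subset.
- apply: filterS xW => y Wy; rewrite -[LHS]/((f y)%:C); have -> // : f y = 1.
  by apply: f1; exists y => //; exact: subset_closure.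
Qed.

(** With k the square root of e^2 - |p|^2, this is the equation that [calkin_eq0_sum_sqr] asks for,
    before transport by [F]. *)
Lemma ck_sum_sqr (p : C) (e : R) : (forall y, normc (fn p y) <= e) ->
  exists k : C, ck_star p * p + ck_star k * k = (e ^+ 2)%:C *: (1 : C).
Proof.
move=> pe; pose f y := Num.sqrt (e ^+ 2 - normc (fn p y) ^+ 2).
have cn : continuous (fun y => normc (fn p y)).
  move=> y; have := @normcB_continuous R 0 (fn p y).
  rewrite (_ : (fun _ => _) = normc); last by apply/funext => z; rewrite subr0.
  exact: (@cvg_comp _ _ _ (fn p) _ _ _ _ (@cts_fun _ _ (fn p) y)).
have cf : continuous f.
  move=> y; apply: (@cvg_comp _ _ _ (fun y => e ^+ 2 - normc (fn p y) ^+ 2) Num.sqrt).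
    by apply: cvgB; [exact: cvg_cst|exact: (cvgM (cn y) (cn y))].
  exact: sqrt_continuous.
exists (mkcts (real_complex_continuous cf)); apply: ckP => y.
have sq (z : R[i]) : z^* * z = (normc z ^+ 2)%:C.
  by rewrite mulrC -sqr_normc normCE rmorphXn.
rewrite -[LHS]/((fn p y)^* * fn p y + ((f y)%:C)^* * (f y)%:C) !sq normc_real.
rewrite -[RHS]/((e ^+ 2)%:C * 1) mulr1 -rmorphD; congr _%:C.
rewrite real_normK ?num_real// sqr_sqrtr ?subrKC//; last first.
by rewrite subr_ge0 ler_sqr ?nnegrE ?normc_ge0// (le_trans (normc_ge0 _) (pe y)).
Qed.

Variables (F : {linear C -> calkin R}) (A : set (calkin R)) (x : K).
Hypotheses (FM : {morph F : f g / f * g}).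
Hypotheses (Fstar : {morph F : f / ck_star f >-> calkin_star f}).
Hypotheses (Fbij : set_bij setT A F) (masaA : masa A).

Let F_inj f g : F f = F g -> f = g.
Proof. by case: Fbij => _ FI _; apply: FI; rewrite inE. Qed.

Let F_surj a : A a -> exists f, F f = a.
Proof. by case: Fbij => _ _ FS /FS[f _ <-]; exists f. Qed.

Lemma calkin_starZ a (q : calkin R) : calkin_star (a *: q) = a^* *: calkin_star q.
Proof.
have [T ->] := calkinP q; rewrite -(to_calkin_scale a T) !calkin_starE.
rewrite -(to_calkin_scale a^* (adjoint T)); congr to_calkin.
apply: (@adjoint_unique _ (a *: T)); first exact: adjointP.
move=> y z; rewrite !bop_scaleE dotl2Zl dotl2Zr adjointP; congr (_ * _).
exact/esym/conjcK.
Qed.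

Lemma calkin_star1 : calkin_star 1 = 1 :> calkin R.
Proof.
rewrite -to_calkin1 calkin_starE; congr to_calkin.
by apply: (@adjoint_unique _ 1); first exact: adjointP.
Qed.

(** The unit commutes with everything, so it lies in the masa and is in the range of [F]. *)
Lemma masa_isomorphism1 : F 1 = 1.
Proof.
have [u Fu] : exists u, F u = 1.
  by apply/F_surj/(masa_mem masaA calkin_star1) => a _; rewrite mulr1 mul1r.
by rewrite -[LHS]mulr1 -Fu -FM mul1r.
Qed.

(** With h = g - g(x), F(h) v = F(h c_U) v for all [U], and h c_U is uniformly small for small [U].
    Hence F(h) v = 0. *)
Lemma eigenvector_of_approximate_unit (B : set (set K)) (c : set K -> C) (v : calkin R) :
  nbhs_basis x B ->
  (forall U, B U -> forall y, normc (fn (c U) y) <= 1) ->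
  (forall U, B U -> forall y, ~ U y -> fn (c U) y = 0) ->
  (forall U, B U -> F (c U) * v = v) -> calkin_star v * v = 1 ->
  forall g, F g * v = fn g x *: v.
Proof.
move=> [_ Bx] c1 c0 cv v1 g; pose h : C := g - fn g x *: (1 : C).
suff : F h * v = 0.
  rewrite /h raddfB/= linearZ/= masa_isomorphism1 mulrBl calkin_mulZl mul1r.
  by move=> /eqP; rewrite subr_eq0 => /eqP.
have hE y : fn h y = fn g y - fn g x by rewrite -[LHS]/(fn g y - fn g x * 1) mulr1.
apply: calkin_eq0_sum_sqr => e e0.
have [U BU Ue] : exists2 U, B U & forall y, U y -> normc (fn h y) <= e.
  have eC : 0 < e%:C :> R[i] by rewrite ltcR.
  have /(@cvgrPdist_lt _ _ _ (nbhs x) (nbhs_filter x))/(_ _ eC) := @cts_fun _ _ (fn g) x.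
  move=> /Bx[U BU UH]; exists U => // y /UH /=.
  rewrite hE normCE ltcR => /ltW; congr (is_true (_ <= _)).
  by apply: complexI; rewrite -!normCE distrC.
have [y|k kE] := @ck_sum_sqr (h * c U) e.
  rewrite -[fn _ y]/(fn h y * fn (c U) y) ComplexField.Normc.normcM.
  have [Uy|nUy] := pselect (U y); last first.
    by rewrite (c0 _ BU _ nUy) ComplexField.Normc.normc0 mulr0 ltW.
  by rewrite -[leRHS]mulr1 ler_pM ?normc_ge0 ?Ue ?c1.
have -> : F h * v = F (h * c U) * v by rewrite FM -mulrA cv.
(* With p = h c_U, the sum of squares is v^* F(p^* p + k^* k) v = e^2 v^* v = e^2. *)
exists (F k * v); rewrite !calkin_starM -!Fstar.
have sand p q : calkin_star v * F p * (F q * v) = calkin_star v * F (p * q) * v.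
  by rewrite FM !mulrA.
rewrite !sand -mulrDl -mulrDr -raddfD/= kE linearZ/= masa_isomorphism1.
by rewrite calkin_mulZr calkin_mulZl mulr1 v1.
Qed.

Lemma character_ge_pseudointersection_number : pseudointersection_number #<= character x.
Proof.
apply: contrapT => pB; set B := character x in pB.
have [bB _] : is_least_card (nbhs_basis x) B by exact: characterP.
have cP U : exists f : C, B U -> [/\ forall y, normc (fn f y) <= 1,
    forall y, ~ U y -> fn f y = 0 & \forall y \near x, fn f y = 1].
  have [BU|nBU] := pselect (B U); last by exists 0.
  by have [f fP] := ck_cutoff (bB.1 _ BU); exists f.
pose c U := projT1 (cid (cP U)).
have cU U : B U -> [/\ forall y, normc (fn (c U) y) <= 1,
    forall y, ~ U y -> fn (c U) y = 0 & \forall y \near x, fn (c U) y = 1].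
  by rewrite /c; case: cid.
pose S U : bop R := 1 - calkin_repr (F (c U)).
have SE U : to_calkin (S U) = 1 - F (c U).
  by rewrite to_calkinB calkin_reprK.
have [G GB finG k|s [sr sA]] := @pseudointersection_sequence _ B
    (fun U => [set m | code_vec m != 0 :> ell2 R /\
      l2norm (val (S U) (code_vec m)) <= 2 ^- (code_rank m) * l2norm (code_vec m : ell2 R)])
    code_rank pB.
  (* A function [h] vanishing off this neighbourhood satisfies c_U h = h for [U] in [G], so [S U]
     times a lift of F(h) is compact; h(x) = 1 and injectivity of [F] keep F(h) nonzero. *)
  have xW : nbhs x (\bigcap_(U in G) [set y | fn (c U) y = 1]).
    move/finite_fsetP : finG GB => [X ->] XB; apply: filter_bigI => U UX.
    by have [] := cU U (XB _ UX).
  have [h [_ h0 h1]] := ck_cutoff xW.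
  have [||m [mk m0 mS]] := @code_vec_approx_kernel _ _ G S (calkin_repr (F h)) finG _ _ k.
  - apply/negP => /to_calkin_eq0; rewrite calkin_reprK -(raddf0 F) => /F_inj h00.
    have := nbhs_singleton h1; rewrite h00 => /eqP.
    by rewrite -[fn _ x]/(0 : R[i]) eq_sym oner_eq0.
  - move=> U GU; apply/to_calkin_eq0; rewrite to_calkin_mul SE calkin_reprK.
    rewrite mulrBl mul1r -FM; apply/eqP; rewrite subr_eq0; apply/eqP; congr (F _).
    apply: ckP => y; rewrite -[RHS]/(fn (c U) y * fn h y).
    have [Wy|nWy] := pselect ((\bigcap_(U in G) [set y | fn (c U) y = 1]) y).
      by rewrite (Wy _ GU) mul1r.
    by rewrite (h0 _ nWy) mulr0.
  - exists m; first by rewrite mk.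
    by move=> U GU; split=> //; rewrite mk; exact: mS.
have B0 : B !=set0 by have [U BU _] := bB.2 _ filterT; exists U.
have [V [VV SV]] := @block_sequence_isometry _ _ B S s B0 sr sA.
pose v := to_calkin V.
have v1 : calkin_star v * v = 1 by rewrite calkin_starE -to_calkin_mul VV.
have Fv g : F g * v = fn g x *: v.
  apply: (@eigenvector_of_approximate_unit B c) => //.
  - by move=> U /cU[].
  - by move=> U /cU[].
  - move=> U BU; have /to_calkin_eq0 := SV U BU.
    rewrite to_calkin_mul SE mulrBl mul1r => /eqP.
    by rewrite subr_eq0 => /eqP <-.
have vF g : calkin_star v * F g = fn g x *: calkin_star v.
  rewrite -[LHS]calkin_starK calkin_starM calkin_starK -Fstar Fv calkin_starZ.
  by congr (_ *: _); exact: conjcK.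
have [D [DD nD]] := @exists_nonscalar_diagonal R.
pose d := to_calkin D.
have dd : calkin_star d = d by rewrite calkin_starE DD.
have [g Fg] : exists g, F g = v * d * calkin_star v.
  apply: F_surj; apply: (masa_mem masaA).
    by rewrite !calkin_starM calkin_starK dd mulrA.
  move=> _ /F_surj[g <-]; rewrite -!mulrA vF !mulrA Fv.
  by rewrite !calkin_mulZr !calkin_mulZl.
(* Compressing F(g) by [v] in two ways gives d = g(x), against the choice of [D]. *)
have : calkin_star v * (F g * v) = d.
  by rewrite Fg -!mulrA v1 mulr1 mulrA v1 mul1r.
rewrite Fv calkin_mulZr v1 => gd; have /negP := nD (fn g x); apply.
apply/to_calkin_eq0; rewrite to_calkinB to_calkin_scale to_calkin1 gd.
exact: subrr.
Qed.

End Characters.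

Theorem theorem1p1 (R : realType) (K : topologicalType)
  (K_compact : compact [set: K]) (K_hausdorff : hausdorff_space K)
  (K_masa : exists A : set (calkin R), masa A /\ star_isomorphic_to K A)
  (x : K) :
  pseudointersection_number #<= character x.
Proof.
have [A [masaA [F [FM Fstar Fbij]]]] := K_masa.
exact: (character_ge_pseudointersection_number K_compact K_hausdorff x FM Fstar Fbij masaA).
Qed.
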